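(* Let $W=\{W(h):h\in\mathfrak{H}\}$ be an isonormal Gaussian process over a real separable Hilbert space $\mathfrak{H}$, defined on a probability space $(\Omega,\mathscr{F},\mathbb{P})$. Fix an integer $q\geq 2$ and let $\{F_n,n\geq 1\}$ be a sequence of random variables in $\bigoplus_{p=0}^{q}\mathbb{C}^W_p$ (the sum of the first $q$ Gaussian Wiener chaoses associated to $W$, together with the constants) such that, as $n\to+\infty$, $F_n$ converges almost surely to some random variable $F$. Then $F$ belongs to $\bigoplus_{p=0}^{q}\mathbb{C}^W_p$. Moreover, for each $p\in\{0,\dots,q\}$, $J_p(F_n)$ converges almost surely to $J_p(F)$ as $n\to+\infty$.
   Context: An isonormal Gaussian process over $\mathfrak{H}$ is a centered Gaussian family $\{W(h):h\in\mathfrak{H}\}$ with $\mathbb{E}[W(h)W(g)]=\langle h,g\rangle_{\mathfrak{H}}$. Let $H_p(x)=(-1)^p e^{x^2/2}\frac{d^p}{dx^p}e^{-x^2/2}$ be the $p$th Hermite polynomial and $\{e_i:i\in\mathbb{N}\}$ an orthonormal basis of $\mathfrak{H}$. The Gaussian Wiener chaos $\mathbb{C}^W_0=\mathbb{R}$ (constants), and for $p\ge1$ the $p$th Gaussian Wiener chaos $\mathbb{C}^W_p$ is the closed subspace of $L^2(\Omega,\sigma\{W\},\mathbb{P})$ having as complete orthonormal system $\{\prod_{i\in\mathbb{N}} H_{a_i}(W(e_i))/\sqrt{a_i!}: a_i\in\mathbb{N}\cup\{0\},\ \sum_i a_i=p\}$. One has the orthogonal decomposition $L^2(\Omega,\sigma\{W\},\mathbb{P})=\bigoplus_{p=0}^\infty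 \mathbb{C}^W_p$, and $J_p$ denotes the orthogonal projection onto $\mathbb{C}^W_p$. *)

(* Defs.v *)
From HB Require Import structures.
From mathcomp Require Import all_boot all_order all_algebra.
From mathcomp Require Import all_classical all_reals all_analysis.
Set Implicit Arguments. Unset Strict Implicit. Unset Printing Implicit Defensive.
Import Order.TTheory GRing.Theory Num.Theory.
Import numFieldNormedType.Exports.
Local Open Scope classical_set_scope.
Local Open Scope ring_scope.

Definition hermite {R : realType} (p : nat) (x : R) : R :=
  (-1) ^+ p * expR (x ^+ 2 / 2)
  * derive1n p (fun y : R => expR (- (y ^+ 2) / 2)) x.

Definition centered_normal_law {R : realType} (v : R) (A : set R) : \bar R :=
  if v == 0 then \d_(0 : R) A else normal_prob 0 (Num.sqrt v) A.

Definition is_inner_product {R : realType} {H : normedModType R}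
  (ip : H -> H -> R) : Prop :=
  [/\ forall x y, ip x y = ip y x,
      forall (a : R) x y z, ip (a *: x + y) z = a * ip x z + ip y z
    & forall x, ip x x = `|x| ^+ 2].

Definition is_orthonormal_basis {R : realType} {H : normedModType R}
  (ip : H -> H -> R) {I : eqType} (e : I -> H) : Prop :=
  (forall i j, ip (e i) (e j) = (i == j)%:R) /\
  (forall h, (forall i, ip h (e i) = 0) -> h = 0).

(* W is an isonormal Gaussian process over (H, ip): a centered Gaussian
   family (every finite linear combination is a centered normal random
   variable) with covariance E[W(h)W(g)] = <h,g>. *)
Definition isonormal {R : realType} {H : normedModType R} (ip : H -> H -> R)
  {d} {Omega : measurableType d} (P : probability Omega R)
  (W : H -> Omega -> R) : Prop :=
  (forall h, measurable_fun setT (W h)) /\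
  forall s : seq (R * H),
    forall A : set R, measurable A ->
      P ((fun w => \sum_(k <- s) k.1 * W k.2 w) @^-1` A) =
      centered_normal_law (\sum_(j <- s) \sum_(k <- s) j.1 * k.1 * ip j.2 k.2) A.

Definition L2 {R : realType} {d} {Omega : measurableType d}
  (P : probability Omega R) (X : Omega -> R) : Prop :=
  measurable_fun setT X /\ P.-integrable setT (fun w => (X w ^+ 2)%:E).

(* finite linear combinations of the orthonormal system of the p-th chaos:
   prod_i H_{a_i}(W(e_i)) / sqrt(a_i!), sum_i a_i = p *)
Definition chaos_span {R : realType} {H : normedModType R} {I : eqType}
  (e : I -> H) {d} {Omega : measurableType d} (W : H -> Omega -> R)
  (p : nat) (Y : Omega -> R) : Prop :=
  exists (n : nat) (c : nat -> R) (s : nat -> seq I) (a : nat -> I -> nat),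
    (forall k, (k < n)%N -> uniq (s k) /\ (\sum_(i <- s k) a k i)%N = p) /\
    Y = fun w => \sum_(k < n) c k *
          \prod_(i <- s k) (hermite (a k i) (W (e i) w) / Num.sqrt (a k i)`!%:R).

Definition in_chaos {R : realType} {H : normedModType R} {I : eqType}
  (e : I -> H) {d} {Omega : measurableType d} (P : probability Omega R)
  (W : H -> Omega -> R) (p : nat) (X : Omega -> R) : Prop :=
  L2 P X /\
  forall eps : R, 0 < eps -> exists Y, chaos_span e W p Y /\
    (\int[P]_w ((X w - Y w) ^+ 2)%:E < eps%:E)%E.

Definition in_chaos_sum {R : realType} {H : normedModType R} {I : eqType}
  (e : I -> H) {d} {Omega : measurableType d} (P : probability Omega R)
  (W : H -> Omega -> R) (q : nat) (X : Omega -> R) : Prop :=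
  exists Xp : nat -> Omega -> R,
    (forall p, (p <= q)%N -> in_chaos e P W p (Xp p)) /\
    {ae P, forall w, X w = \sum_(p < q.+1) Xp p w}.

Definition is_chaos_proj {R : realType} {H : normedModType R} {I : eqType}
  (e : I -> H) {d} {Omega : measurableType d} (P : probability Omega R)
  (W : H -> Omega -> R) (p : nat) (X Y : Omega -> R) : Prop :=
  in_chaos e P W p Y /\
  forall Z, in_chaos e P W p Z -> (\int[P]_w ((X w - Y w) * Z w)%:E = 0)%E.

(* Main.v *)
Require Import Defs.
From HB Require Import structures.
From mathcomp Require Import all_boot all_order all_algebra.
From mathcomp Require Import all_classical all_reals all_analysis.
From mathcomp Require Import measurable_realfun qpoly ring lra zify.
Import Order.TTheory GRing.Theory Num.Theory.
Import numFieldNormedType.Exports.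
Local Open Scope classical_set_scope.
Local Open Scope ring_scope.
Set Implicit Arguments.
Unset Strict Implicit.
Unset Printing Implicit Defensive.

(* Write xi = (W(e_i))_i, let xi' be an independent copy and let x^2 + y^2 = 1.
   The law of xi is invariant under rotations, so x xi + y xi' has the law of xi.

   Small tails control moments: let f be a polynomial of degree at most q. On the
   circle through xi and xi' it is a trigonometric polynomial, so f(xi) is
   bounded by its values at 2q+1 nodes. Each node may be chosen among two
   orthogonal points eta and eta', again independent copies of xi: take eta' if
   |f(eta')| <= delta, and eta otherwise, at the cost of
   E[f(eta)^2; |f(eta')| > delta] = E f(xi)^2 * P(|f(xi)| > delta). If that
   probability is small enough, depending on q only, this is absorbed and
   E f(xi)^2 <= K delta^2. Hence a.s. convergent sequences of such polynomials are
   Cauchy in L^2.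

   Separating the chaoses: approximate F_n in L^2, with summable errors, by
   polynomials G_n(xi) = sum_p g_{n,p}(xi) with g_{n,p}(xi) in the p-th chaos.
   Then G_n(x xi + y xi') converges a.s. as well, so for almost every value a of
   xi the polynomials G_n(x a + y xi') converge a.s., hence in L^2 and in mean.
   By Mehler's formula this mean is sum_p x^p g_{n,p}(a); using q+1 distinct
   values of x, every g_{n,p}(a) converges. *)

(** * The standard normal distribution *)

(** The obstacle is that the polynomials approximating F_n involve an unbounded number of Gaussian
    coordinates, so finite-dimensional compactness is of no help: every constant must depend on the
    degree alone. Interpolation on a circle achieves this, since it takes place in the plane of two
    points whatever the number of coordinates.

    Convergence of a sequence of polynomials is an event in infinitely many coordinates. Rotation
    invariance is therefore needed for laws on a product sigma-algebra, and it is derived from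
    Fourier transforms, where cosines with a phase replace complex exponentials.

    Rotations also supply independence and orthogonality: taking one coordinate from the second copy
    preserves the law, which factorizes products, and exchanging xi with x xi + y xi' shows that
    distinct chaoses are orthogonal. Orthogonality in turn identifies the projections of the
    conclusion with the limits found for the polynomial components. *)

Section gaussian_density.
Context {R : realType}.
Local Notation leb := (@lebesgue_measure R).
Local Notation phi := (normal_pdf (0 : R) 1).

Lemma normal_pdf01E (x : R) : phi x = normal_peak 1 * expR (- x ^+ 2 / 2).
Proof.
by rewrite normal_pdfE ?oner_eq0// /normal_fun subr0 expr1n mulNr.
Qed.

(** Completing the square: an exponential tilt shifts the mean, so tilted densities inherit
    integrability from normal ones. *)
Lemma normal_pdf_expR (m x : R) :
  expR (m * x) * phi x = expR (m ^+ 2 / 2) * normal_pdf m 1 x.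
Proof.
rewrite normal_pdf01E normal_pdfE ?oner_eq0// /normal_fun expr1n.
rewrite mulrCA [RHS]mulrCA; congr (_ * _); rewrite -!expRD; congr expR.
by field.
Qed.

Lemma integrable_expR_normal_pdf (m : R) :
  leb.-integrable setT (EFin \o (fun x => expR (m * x) * phi x)).
Proof.
have -> : EFin \o (fun x => expR (m * x) * phi x) =
    (fun x => (expR (m ^+ 2 / 2))%:E * (normal_pdf m 1 x)%:E)%E.
  by apply/funext => x /=; rewrite normal_pdf_expR EFinM.
by apply: integrableZl => //; exact: integrable_normal_pdf.
Qed.

(** A single term of the exponential series dominates the power; the second exponential takes care
    of negative x. *)
Lemma exprn_le_expR (k : nat) (x : R) :
  `|x| ^+ k <= k`!%:R * (expR x + expR (- x)).
Proof.
have H (y : R) : 0 <= y -> y ^+ k <= k`!%:R * expR y.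
  move=> y0; case: k => [|k]; first by rewrite expr0 mul1r -[leLHS]expR0 ler_expR.
  have /= := expR_ge1Dxn k y0.
  have f0 : 0 < (k.+1)`!%:R :> R by rewrite ltr0n fact_gt0.
  move=> h; rewrite mulrC -ler_pdivrMr//; apply: le_trans h; rewrite lerDr//.
have f0 : 0 <= k`!%:R :> R by rewrite ler0n.
have [x0|x0] := lerP 0 x.
  by rewrite ger0_norm// (le_trans (H _ x0))// ler_wpM2l// lerDl expR_ge0.
have x0' : 0 <= - x by rewrite oppr_ge0 ltW.
rewrite ltr0_norm// (le_trans (H _ x0'))//.
by rewrite ler_wpM2l// lerDr expR_ge0.
Qed.

(** A growth class containing polynomials and bounded functions, integrable against the normal
    density. The rate is fixed at 1, so it is stable under sums and scalings but not under
    products. *)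
Definition exp_bounded (f : R -> R) :=
  exists C, forall x, `|f x| <= C * (expR x + expR (- x)).

Lemma exp_boundedD f g : exp_bounded f -> exp_bounded g ->
  exp_bounded (fun x => f x + g x).
Proof.
move=> [C Cf] [D Dg]; exists (C + D) => x.
by rewrite mulrDl (le_trans (ler_normD _ _))// lerD.
Qed.

Lemma exp_boundedZ c f : exp_bounded f -> exp_bounded (fun x => c * f x).
Proof.
by move=> [C Cf]; exists (`|c| * C) => x; rewrite normrM -mulrA ler_wpM2l.
Qed.

Lemma exp_bounded_exprn k : exp_bounded (fun x => x ^+ k).
Proof. by exists k`!%:R => x; rewrite normrX exprn_le_expR. Qed.

Lemma exp_bounded_horner (p : {poly R}) : exp_bounded (fun x => p.[x]).
Proof.
elim/poly_ind: p (0%N) => [|p c IH] k.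
  by exists 0 => x; rewrite horner0 normr0 mul0r.
(* The class is not stable under multiplication by x, so the Horner induction carries a spare power
   of x. *)
suff H : forall n, exp_bounded (fun x : R => (p * 'X + c%:P).[x] * x ^+ n).
  by have [C HC] := H 0%N; exists C => x; have := HC x; rewrite expr0 mulr1.
elim/poly_ind: p c {IH} => [|p d IH] c n.
  have [C HC] := exp_boundedZ c (exp_bounded_exprn n).
  by exists C => x; rewrite mul0r add0r hornerC.
have := exp_boundedD (IH d n.+1) (exp_boundedZ c (exp_bounded_exprn n)).
move=> [C HC]; exists C => x; have := HC x; congr (`|_| <= _).
by rewrite !hornerE exprS; ring.
Qed.

Lemma exp_bounded_integrable f : measurable_fun setT f -> exp_bounded f ->
  leb.-integrable setT (EFin \o (fun x => f x * phi x)).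
Proof.
move=> mf [C Cf].
apply: (@le_integrable _ _ _ leb setT _ _
  (EFin \o (fun x => C * ((expR (1 * x) * phi x) + (expR (- 1 * x) * phi x))))) => //.
- apply/measurable_EFinP; apply: measurable_funM => //.
  exact: measurable_normal_pdf.
- move=> x _ /=; rewrite lee_fin normrM (ger0_norm (normal_pdf_ge0 _ _ _)).
  apply: (@le_trans _ _ (C * (expR x + expR (- x)) * phi x)).
    by rewrite ler_wpM2r// normal_pdf_ge0.
  rewrite mul1r mulN1r -mulrDl mulrA; exact: ler_norm.
- have H := integrableD measurableT (integrable_expR_normal_pdf 1)
    (integrable_expR_normal_pdf (- 1)).
  exact: (integrableZl measurableT C H).
Qed.

(** The fundamental theorem of calculus on growing symmetric intervals, then dominated convergence
    to reach the whole line. *)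
Lemma Rintegral_derive_eq0 (h h' : R -> R) :
  (forall x, is_derive x (1 : R) h (h' x)) -> continuous h' ->
  leb.-integrable setT (EFin \o h') ->
  h n%:R @[n --> \oo] --> 0 -> h (- n%:R) @[n --> \oo] --> 0 ->
  (\int[leb]_x h' x = 0)%R.
Proof.
move=> dh ch ih h0 h0'.
have ftc (n : nat) : (\int[leb]_x (h' x * \1_(`[- n.+1%:R, n.+1%:R]) x)%:E =
   (h n.+1%:R)%:E - (h (- n.+1%:R))%:E)%E.
  rewrite -(@continuous_FTC2 _ h' h) ?gtrN ?ltr0n//.
  - rewrite [RHS]integral_mkcond; apply: eq_integral => x _.
    by rewrite patchE indicE; case: ifP => _; rewrite ?mulr1 ?mulr0.
  - exact: continuous_subspaceT.
  - have ch0 : continuous h.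
      by move=> x; apply/differentiable_continuous/derivable1_diffP; case: (dh x).
    split.
    + by move=> x _; case: (dh x).
    + exact/cvg_at_right_filter/ch0.
    + exact/cvg_at_left_filter/ch0.
  - by move=> x _; rewrite derive1E; have := dh x => ?; rewrite derive_val.
have cvg1 : (\int[leb]_x (h' x * \1_(`[- n.+1%:R, n.+1%:R]) x)%:E @[n --> \oo] -->
    \int[leb]_x (h' x)%:E)%E.
  apply: (@dominated_cvg _ _ _ leb setT _ _ _ (EFin \o (@Num.norm _ _ \o h'))) => //.
  - move=> n; apply/measurable_EFinP; apply: measurable_funM => //.
    apply/measurable_EFinP; exact: (measurable_int leb ih).
  - move=> x _; apply: cvg_near_cst; near=> n.
    rewrite indicE mem_set ?mulr1//= in_itv/= -ler_norml.
    apply: (@le_trans _ _ n%:R); last by rewrite ler_nat.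
    near: n; exact: nbhs_infty_ger.
  - exact: integrable_norm.
  - move=> n x _ /=; rewrite lee_fin normrM ler_piMr// indicE.
    by case: (_ \in _); rewrite /= ?normr1 ?normr0.
have cvg2 : (\int[leb]_x (h' x * \1_(`[- n.+1%:R, n.+1%:R]) x)%:E @[n --> \oo] --> 0)%E.
  rewrite (_ : (fun _ => _) = EFin \o (fun n => h n.+1%:R - h (- n.+1%:R))); last first.
    by apply/funext => n; rewrite ftc.
  apply/cvg_EFin; first by near=> n.
  rewrite -(subr0 0); apply: cvgB.
  - by rewrite (@cvg_shiftS _ (fun n => h n%:R)).
  - by rewrite (@cvg_shiftS _ (fun n => h (- n%:R))).
rewrite /Rintegral.
by rewrite (cvg_unique _ cvg1 cvg2).
Unshelve. all: by end_near. Qed.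

End gaussian_density.

(** * Stein's identity and the Fourier transform of the normal law *)

Section gaussian_expectation.
Context {R : realType}.
Local Notation leb := (@lebesgue_measure R).
Local Notation phi := (normal_pdf (0 : R) 1).
Local Notation gE f := (\int[leb]_x (f x * phi x))%R.

Lemma is_derive_normal_pdf (x : R) : is_derive x (1 : R) phi (- x * phi x).
Proof.
have -> : phi = (fun y => normal_peak 1 * expR (- y ^+ 2 / 2)).
  by apply/funext => y; rewrite normal_pdf01E.
apply: is_derive_eq.
by rewrite /GRing.scale/=; field.
Qed.

(** With [s] equal to 1 or -1, this removes both boundary terms in Stein's integration by parts. *)
Lemma exp_bounded_mulX_pdf_cvg0 (f : R -> R) (s : R) : `|s| = 1 -> exp_bounded f ->
  (f (s * n%:R) * phi (s * n%:R)) @[n --> \oo] --> 0.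
Proof.
move=> s1 [C Cf].
(* The factor e^2 comes from - n^2/2 <= 2 - 2n, that is (n - 2)^2 >= 0. One e^(-n) absorbs the
   growth of f, the other remains. *)
pose K := `|C| * 2 * normal_peak 1 * expR (2 : R).
apply/norm_cvg0P.
apply: (@squeeze_cvgr _ _ _ _ (fun=> 0) (fun n => K * expR (- n%:R))).
- apply: nearW => n; rewrite normr_ge0/=.
  rewrite normrM (ger0_norm (normal_pdf_ge0 _ _ _)) normal_pdf01E.
  have sn : `|s * n%:R| = n%:R by rewrite normrM s1 mul1r normr_nat.
  have H1 : expR (s * n%:R) + expR (- (s * n%:R)) <= 2 * expR n%:R.
    by rewrite mulrDl mul1r lerD// ler_expR -[leRHS]sn ?ler_norm// -normrN ler_norm.
  have H2 : expR (- (s * n%:R) ^+ 2 / 2) <= expR 2 * expR (- n%:R) * expR (- n%:R).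
    rewrite -!expRD ler_expR -(real_normK (num_real (s * _))) sn.
    by have := sqr_ge0 (n%:R - 2 : R); nra.
  apply: (@le_trans _ _ (`|C| * (2 * expR n%:R) *
      (normal_peak 1 * (expR 2 * expR (- n%:R) * expR (- n%:R))))).
    apply: ler_pM => //.
    + by rewrite mulr_ge0 ?normal_peak_ge0 ?expR_ge0.
    + apply: (le_trans (Cf _)); apply: (le_trans (ler_norm _)); rewrite normrM.
      rewrite ler_wpM2l// ger0_norm// addr_ge0// ?expR_ge0.
    + by rewrite ler_wpM2l// normal_peak_ge0.
  have := expRxMexpNx_1 (n%:R : R) => e1.
  rewrite le_eqVlt; apply/orP; left; apply/eqP; rewrite /K.
  transitivity (`|C| * 2 * normal_peak 1 * expR 2 * expR (- n%:R) *
     (expR n%:R * expR (- n%:R))); first by ring.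
  by rewrite e1 mulr1.
- exact: cvg_cst.
- rewrite -(mulr0 K); apply: cvgM; first exact: cvg_cst.
  exact: cvgn_expR.
Qed.

(** The function f phi vanishes at infinity and has derivative (f' - x f) phi. *)
Lemma stein (f f' : R -> R) :
  (forall x, is_derive x (1 : R) f (f' x)) -> continuous f' ->
  exp_bounded f -> exp_bounded f' -> exp_bounded (fun x => x * f x) ->
  gE (fun x => x * f x) = gE f'.
Proof.
move=> df cf' bf bf' bxf.
have cf : continuous f.
  by move=> x; apply/differentiable_continuous/derivable1_diffP; case: (df x).
have mf : measurable_fun setT f by exact: continuous_measurable_fun.
have mf' : measurable_fun setT f' by exact: continuous_measurable_fun.
have mxf : measurable_fun setT (fun x : R => x * f x) by exact: measurable_funM.
have if' := exp_bounded_integrable mf' bf'.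
have ixf := exp_bounded_integrable mxf bxf.
apply/esym/eqP; rewrite -subr_eq0 -RintegralB//; apply/eqP.
apply: (@Rintegral_derive_eq0 _ (fun x => f x * phi x)) => //.
- move=> x; have := df x; have := is_derive_normal_pdf x => ? ?.
  apply: is_derive_eq; rewrite /GRing.scale/=; ring.
- move=> x; apply: cvgB; apply: cvgM.
  + exact: cf'.
  + exact/continuous_normal_pdf/oner_neq0.
  + by apply: cvgM; [exact: cvg_id|exact: cf].
  + exact/continuous_normal_pdf/oner_neq0.
- exact: (integrableB measurableT if' ixf).
- have := exp_bounded_mulX_pdf_cvg0 (normr1 _) bf.
  by under eq_fun do rewrite mul1r.
- have := exp_bounded_mulX_pdf_cvg0 (s := -1) _ bf.
  by rewrite normrN1 => /(_ erefl); under eq_fun do rewrite mulN1r.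
Qed.

Lemma stein_poly (p : {poly R}) :
  gE (fun x => x * p.[x]) = gE (fun x => p^`().[x]).
Proof.
apply: stein.
- exact: continuous_horner.
- exact: exp_bounded_horner.
- exact: exp_bounded_horner.
- have [C HC] := exp_bounded_horner ('X * p).
  by exists C => x; have := HC x; rewrite hornerM hornerX.
Qed.

Lemma exp_bounded_bounded (f : R -> R) : (forall x, `|f x| <= 1) ->
  exp_bounded f /\ exp_bounded (fun x => x * f x).
Proof.
move=> f1; split.
  exists 1 => x; rewrite mul1r (le_trans (f1 x))//.
  by have := exprn_le_expR 0 x; rewrite expr0 mul1r.
have [C HC] := exp_bounded_exprn (R := R) 1; exists C => x.
rewrite normrM; apply: le_trans (HC x); rewrite expr1.
by rewrite ler_piMr.
Qed.

(** Differentiating under the integral, with dominating function |x| phi, gives -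
    E[x sin (s x + b)]; Stein's identity turns this into - s times the original integral. *)
Lemma gE_cosD_derive (b s : R) :
  is_derive s (1 : R) (fun s : R => gE (fun x => cos (s * x + b)))
    (- s * gE (fun x => cos (s * x + b))).
Proof.
pose f (s x : R) := cos (s * x + b) * phi x.
have dcos (c x : R) : is_derive x (1 : R) (fun y => cos (c * y + b)) (- c * sin (c * x + b)).
  by apply: is_derive_eq; rewrite /GRing.scale/=; ring.
have dsin (c x : R) : is_derive x (1 : R) (fun y => sin (c * y + b)) (c * cos (c * x + b)).
  by apply: is_derive_eq; rewrite /GRing.scale/=; ring.
have ccos (c : R) : continuous (fun y : R => cos (c * y + b)).
  by move=> x; apply/differentiable_continuous/derivable1_diffP; case: (dcos c x).
have csin (c : R) : continuous (fun y : R => sin (c * y + b)).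
  by move=> x; apply/differentiable_continuous/derivable1_diffP; case: (dsin c x).
have bcos (c : R) := @exp_bounded_bounded (fun x => cos (c * x + b)) (fun x => cos_max _).
have bsin (c : R) := @exp_bounded_bounded (fun x => sin (c * x + b)) (fun x => sin_max _).
have dcos1 (a x : R) : is_derive a (1 : R) (fun y => cos (y * x + b)) (- x * sin (a * x + b)).
  by apply: is_derive_eq; rewrite /GRing.scale/=; ring.
have df1 (a x : R) : is_derive a (1 : R) (f ^~ x) (- x * sin (a * x + b) * phi x).
  have -> : f ^~ x = phi x \*: (fun y => cos (y * x + b)).
    by apply/funext => y; rewrite /f /= /GRing.scale/= mulrC.
  by have := dcos1 a x => ?; apply: is_derive_eq; rewrite /GRing.scale/=; ring.
have d1 a x : partial1of2 f a x = - x * sin (a * x + b) * phi x.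
  by rewrite partial1of2E; have := df1 a x => ?; rewrite derive_val.
have intf a : leb.-integrable setT (EFin \o f a).
  apply: (exp_bounded_integrable (f := fun x => cos (a * x + b))).
    exact: (continuous_measurable_fun (ccos a)).
  exact: (bcos a).1.
have df a x : derivable (f ^~ x) a 1 by case: (df1 a x).
pose G (x : R) := `|x| * phi x.
have G0 x : 0 <= G x by rewrite mulr_ge0// normal_pdf_ge0.
have iG : leb.-integrable setT (EFin \o G).
  apply: (exp_bounded_integrable (f := fun x => `|x|)).
    exact: measurableT_comp.
  have [C HC] := exp_bounded_exprn (R := R) 1; exists C => x.
  by rewrite normr_id; have := HC x; rewrite expr1.
have Gub a x : `|partial1of2 f a x| <= G x.
  rewrite d1 !normrM normrN (ger0_norm (normal_pdf_ge0 _ _ _)) ler_wpM2r ?normal_pdf_ge0//.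
  by rewrite ler_piMr// sin_max.
have Is : (`](s - 1), (s + 1)[%classic : set R) s.
  by rewrite /= in_itv/=; apply/andP; split; lra.
have D1 := @derivable_under_integral _ _ _ leb f setT measurableT s _ _ Is
  (fun x _ => intf x) (fun x y _ _ => df x y) G G0 iG (fun x y _ _ => Gub x y).
have D2 := @differentiation_under_integral _ _ _ leb f setT measurableT s _ _ Is
  (fun x _ => intf x) (fun x y _ _ => df x y) G G0 iG (fun x y _ _ => Gub x y).
apply: DeriveDef; first exact: D1.
rewrite -derive1E D2.
transitivity (- gE (fun x => x * sin (s * x + b))).
  rewrite -[RHS]mulN1r -RintegralZl//.
    by apply: eq_Rintegral => x _; rewrite d1; ring.
  apply: (exp_bounded_integrable (f := fun x => x * sin (s * x + b))).
    by apply: measurable_funM => //; exact: (continuous_measurable_fun (csin s)).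
  exact: (bsin s).2.
rewrite mulNr; congr (- _).
rewrite (@stein _ (fun x => s * cos (s * x + b))).
- rewrite -RintegralZl//.
    by apply: eq_Rintegral => x _; rewrite mulrA.
  exact: intf.
- by move=> x; apply: cvgM; [exact: cvg_cst|exact: ccos].
- exact: (bsin s).1.
- by apply: exp_boundedZ; exact: (bcos s).1.
- exact: (bsin s).2.
Qed.

(** The linear differential equation just found is solved by checking that multiplication by
    e^(s^2/2) yields a constant. The phase [b] covers sines as well. *)
Lemma gE_cosD (b s : R) : gE (fun x => cos (s * x + b)) = cos b * expR (- s ^+ 2 / 2).
Proof.
pose c (s : R) := gE (fun x => cos (s * x + b)).
have c0 : c 0 = cos b.
  transitivity (\int[leb]_x (cos b * phi x))%R; last first.
    rewrite RintegralZl//; last exact: integrable_normal_pdf.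
    by rewrite /Rintegral integral_normal_pdf mulr1.
  by apply: eq_Rintegral => x _; rewrite mul0r add0r.
have H x : is_derive x (1 : R) (fun y => c y * expR (y ^+ 2 / 2)) 0.
  have := gE_cosD_derive b x => ?.
  by apply: is_derive_eq; rewrite /GRing.scale/= -/(c x); field.
have := @is_derive_0_is_cst _ _ s 0 H.
rewrite c0 expr0n/= mul0r expR0 mulr1 => e.
by rewrite -/(c s) mulNr expRN -e mulfK// gt_eqF// expR_gt0.
Qed.

Lemma gE_cos (s : R) : gE (fun x => cos (s * x)) = expR (- s ^+ 2 / 2).
Proof.
have := gE_cosD 0 s; rewrite cos0 mul1r => <-.
by apply: eq_Rintegral => x _; rewrite addr0.
Qed.

End gaussian_expectation.

(** * Bounded random variables and Fubini's theorem *)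

Section bounded_random_variables.
Context d (T : measurableType d) (R : realType) (P : probability T R).

Lemma bounded_integrable (f : T -> R) (C : R) : measurable_fun setT f ->
  (forall x, `|f x| <= C) -> P.-integrable setT (EFin \o f).
Proof.
move=> mf fC.
apply: (@le_integrable _ _ _ P setT measurableT _ (EFin \o cst C)).
- exact/measurable_EFinP.
- by move=> x _; rewrite /= lee_fin (le_trans (fC x))// ler_norm.
- exact: finite_measure_integrable_cst.
Qed.

Lemma EFin_Rintegral (f : T -> R) : P.-integrable setT (EFin \o f) ->
  (\int[P]_x f x)%R%:E = (\int[P]_x (f x)%:E)%E.
Proof. by move=> fi; rewrite /Rintegral fineK//; exact: integrable_fin_num fi. Qed.

Lemma bounded_cvg_Rintegral (f_ : nat -> T -> R) (f : T -> R) (C : R) :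
  (forall n, measurable_fun setT (f_ n)) -> (forall n x, `|f_ n x| <= C) ->
  (forall x, f_ n x @[n --> \oo] --> f x) ->
  (\int[P]_x f_ n x)%R @[n --> \oo] --> (\int[P]_x f x)%R.
Proof.
move=> mf fC fcvg.
have mlim : measurable_fun setT f by apply: (measurable_fun_cvg mf) => x _; exact: fcvg.
have limC x : `|f x| <= C.
  have h : `|f_ n x| @[n --> \oo] --> `|f x| by apply: cvg_norm; exact: fcvg.
  rewrite -(cvg_lim _ h)//; apply: limr_le; first by apply/cvg_ex; exists `|f x|.
  by apply: nearW.
apply: fine_cvg; rewrite (EFin_Rintegral (bounded_integrable mlim limC)).
apply: (@dominated_cvg _ _ _ P setT measurableT (fun n => EFin \o f_ n) (EFin \o f) (EFin \o cst C)) => //.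
- by move=> n; exact/measurable_EFinP.
- by move=> x _; apply: cvg_EFin; [exact: nearW|exact: fcvg].
- exact: finite_measure_integrable_cst.
- by move=> n x _; rewrite /= lee_fin.
Qed.

End bounded_random_variables.

Lemma Rintegral_Fubini d1 (T1 : measurableType d1) d2 (T2 : measurableType d2)
  (R : realType) (P1 : probability T1 R) (P2 : probability T2 R) (f : T1 * T2 -> R) :
  (P1 \x P2)%E.-integrable setT (EFin \o f) ->
  (forall x, P2.-integrable setT (fun y => (f (x, y))%:E)) ->
  (forall y, P1.-integrable setT (fun x => (f (x, y))%:E)) ->
  (\int[P1]_x \int[P2]_y f (x, y) = \int[P2]_y \int[P1]_x f (x, y))%R /\
  (\int[P1]_x \int[P2]_y f (x, y) = \int[(P1 \x P2)%E]_z f z)%R.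
Proof.
move=> intf if1 if2.
have e1 : (\int[P1]_x \int[P2]_y f (x, y))%R = fine (\int[P1]_x \int[P2]_y (f (x, y))%:E)%E.
  congr fine; apply: eq_integral => x _; rewrite fineK//.
  exact: integrable_fin_num (if1 x).
have e2 : (\int[P2]_y \int[P1]_x f (x, y))%R = fine (\int[P2]_y \int[P1]_x (f (x, y))%:E)%E.
  congr fine; apply: eq_integral => x _; rewrite fineK//.
  exact: integrable_fin_num (if2 x).
rewrite e1 e2; split; congr fine.
- exact: (Fubini intf).
- exact: (integral12_prod_meas1 intf).
Qed.

Lemma bounded_Fubini d1 (T1 : measurableType d1) d2 (T2 : measurableType d2)
  (R : realType) (P1 : probability T1 R) (P2 : probability T2 R) (f : T1 * T2 -> R) (C : R) :
  measurable_fun setT f -> (forall z, `|f z| <= C) ->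
  (\int[P1]_x \int[P2]_y f (x, y) = \int[P2]_y \int[P1]_x f (x, y))%R /\
  (\int[P1]_x \int[P2]_y f (x, y) = \int[(P1 \x P2)%E]_z f z)%R.
Proof.
move=> mf fC; apply: Rintegral_Fubini.
- exact: (@bounded_integrable _ _ _ (P1 \x P2)%E _ C).
- move=> x; apply: (@bounded_integrable _ _ _ P2 (fun y => f (x, y)) C) => //.
  exact: measurableT_comp mf (pair1_measurable x).
- move=> y; apply: (@bounded_integrable _ _ _ P1 (fun x => f (x, y)) C) => //.
  exact: measurableT_comp mf (pair2_measurable y).
Qed.

(** * Integration against the standard normal law *)

Section integral_normal01.
Context {R : realType}.
Local Notation leb := (@lebesgue_measure R).
Local Notation phi := (normal_pdf (0 : R) 1).
Local Notation N := (normal_prob (0 : R) 1).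
Import HBNNSimple.

(** On the level sets of simple functions this is the definition of [normal_prob]; monotone
    convergence does the rest. *)
Lemma ge0_integral_normal01 (f : R -> \bar R) : measurable_fun setT f ->
  (forall x, 0 <= f x)%E ->
  (\int[N]_x f x = \int[leb]_x (f x * (phi x)%:E))%E.
Proof.
move=> mf f0.
have mphi : measurable_fun setT (fun x : R => (phi x)%:E).
  by apply/measurable_EFinP; exact: measurable_normal_pdf.
have phi0 x : (0 <= (phi x)%:E)%E by rewrite lee_fin normal_pdf_ge0.
have mC : measurable_fun setT (fun x => f x * (phi x)%:E)%E by exact: emeasurable_funM.
pose f_ := nnsfun_approx measurableT mf.
have mf_ n : measurable_fun setT (fun x => (f_ n x)%:E) by exact/measurable_EFinP.
have fcvg x : ((f_ n x)%:E @[n --> \oo] --> f x)%E by exact: cvg_nnsfun_approx.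
have mono (x : R) : {homo (fun n => (f_ n x)%:E) : a b / (a <= b)%N >-> (a <= b)%E}.
  by move=> a b ab; rewrite lee_fin; exact/lefP/nd_nnsfun_approx.
transitivity (limn (fun n => \int[N]_x (f_ n x)%:E))%E.
  rewrite -monotone_convergence//=.
  - by apply: eq_integral => x _; apply/esym/cvg_lim => //; exact: fcvg.
  - by move=> n x _; rewrite lee_fin.
transitivity (limn (fun n => \int[leb]_x ((f_ n x)%:E * (phi x)%:E)))%E; last first.
  rewrite -monotone_convergence//=.
  - apply: eq_integral => x _; apply/cvg_lim => //.
    by apply: cvgeMr => //; exact: fcvg.
  - move=> n; apply: emeasurable_funM => //.
    exact: mf_.
  - by move=> n x _; rewrite mule_ge0// lee_fin.
  - by move=> x _ a b ab; rewrite lee_wpmul2r//; exact: mono.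
apply/congr_lim/funext => n.
have cA r : (\int[N]_x (\1_(f_ n @^-1` [set r]) x)%:E =
    \int[leb]_x ((\1_(f_ n @^-1` [set r]) x)%:E * (phi x)%:E))%E.
  have mA : measurable (f_ n @^-1` [set r]) by [].
  rewrite integral_indic//= (_ : _ `&` _ = f_ n @^-1` [set r]); last exact: setIT.
  rewrite /normal_prob integral_mkcond.
  apply: eq_integral => x _; rewrite patchE indicE.
  by case: ifP => _; rewrite ?mul1e ?mul0e.
have mi (r : R) : measurable_fun setT (fun x => (\1_(f_ n @^-1` [set r]) x : R)%:E).
  exact/measurable_EFinP.
have m1 (r : R) : measurable_fun setT (fun x => r * \1_(f_ n @^-1` [set r]) x) by exact: measurable_funM.
under eq_integral do rewrite fimfunE -fsumEFin//.
rewrite [LHS]ge0_integral_fsum//; last 2 first.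
  - by move=> r; apply/measurable_EFinP; exact: m1.
  - by move=> r x _; rewrite EFinM nnfun_muleindic_ge0.
under [RHS]eq_integral.
  move=> x xD; rewrite fimfunE -fsumEFin// ge0_mule_fsuml; last first.
    by move=> r; rewrite EFinM nnfun_muleindic_ge0.
  over.
rewrite [RHS]ge0_integral_fsum//; last 2 first.
  - by move=> r; apply: emeasurable_funM => //; apply/measurable_EFinP; exact: m1.
  - by move=> r x _; rewrite mule_ge0// EFinM nnfun_muleindic_ge0.
apply: eq_fsbigr => r /set_mem[y _ <-].
have r0 : (0 <= (f_ n y)%:E)%E by rewrite lee_fin.
transitivity ((f_ n y)%:E * \int[N]_x (\1_(f_ n @^-1` [set f_ n y]) x)%:E)%E.
  rewrite -(@ge0_integralZl _ _ _ N setT measurableT _ (mi (f_ n y)) _ _ r0)//.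
rewrite cA -(@ge0_integralZl _ _ _ leb setT measurableT _ _ _ _ r0)//.
- by apply: eq_integral => x _; rewrite EFinM muleA.
- by apply: emeasurable_funM => //; exact: mi.
- by move=> x _; rewrite mule_ge0// lee_fin.
Qed.

Lemma integral_normal01 (f : R -> R) : measurable_fun setT f -> exp_bounded f ->
  N.-integrable setT (EFin \o f) /\
  (\int[N]_x f x = \int[leb]_x (f x * phi x))%R.
Proof.
move=> mf bf.
have mf' : measurable_fun setT (EFin \o f) by exact/measurable_EFinP.
have if' := exp_bounded_integrable mf bf.
have iN : N.-integrable setT (EFin \o f).
  apply/integrableP; split=> //.
  rewrite ge0_integral_normal01//; last exact: measurableT_comp.
  have [_ +] := integrableP _ _ _ if'; apply: le_lt_trans.
  rewrite le_eqVlt; apply/orP; left; apply/eqP; apply: eq_integral => x _.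
  by rewrite /= -EFinM normrM (ger0_norm (normal_pdf_ge0 _ _ _)).
split=> //; congr fine.
rewrite integralE [RHS]integralE.
rewrite !ge0_integral_normal01//.
- congr (_ - _)%E; apply: eq_integral => x _.
  + rewrite !funeposE/= -!EFin_max -EFinM; congr EFin.
    by rewrite maxr_pMl ?normal_pdf_ge0// mul0r.
  + have e (r : R) : maxe (- r%:E)%E 0%E = (Num.max (- r) 0)%:E by rewrite EFin_max.
    rewrite !funenegE/= !e -EFinM; congr EFin.
    by rewrite maxr_pMl ?normal_pdf_ge0// mul0r mulNr.
- exact: measurable_funeneg.
- exact: measurable_funepos.
Qed.
End integral_normal01.

(** * Laws determined by their Fourier transforms *)

Section fourier_uniqueness.
Context {R : realType} d1 (T1 : measurableType d1) (P1 : probability T1 R)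
  d2 (T2 : measurableType d2) (P2 : probability T2 R).
Variables (X1 : T1 -> R) (X2 : T2 -> R) (R1 : T1 -> R) (R2 : T2 -> R).
Hypotheses (mX1 : measurable_fun setT X1) (mX2 : measurable_fun setT X2).
Hypotheses (mR1 : measurable_fun setT R1) (mR2 : measurable_fun setT R2).
Hypotheses (bR1 : forall w, `|R1 w| <= 1) (bR2 : forall w, `|R2 w| <= 1).

(** The weights [R1] and [R2] will carry the other coordinates of a family, so that a joint law can
    be treated one coordinate at a time. Measurability and boundedness are included so that bounded
    pointwise limits stay in the class. *)
Definition same_expectation (g : R -> R) :=
  [/\ measurable_fun setT g, exists C, forall x, `|g x| <= C &
   (\int[P1]_w (R1 w * g (X1 w)) = \int[P2]_w (R2 w * g (X2 w)))%R].

Hypothesis Hcos : forall t b, same_expectation (fun x => cos (t * x + b)).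

Local Notation N := (normal_prob (0 : R) 1).

Let integrable1 (g : R -> R) (C : R) : measurable_fun setT g -> (forall x, `|g x| <= C) ->
  P1.-integrable setT (EFin \o (fun w => R1 w * g (X1 w))).
Proof.
move=> mg gC; apply: (@bounded_integrable _ _ _ P1 _ C).
  by apply: measurable_funM => //; exact: measurableT_comp.
move=> w; rewrite normrM -[leRHS]mul1r.
by apply: ler_pM.
Qed.

Let integrable2 (g : R -> R) (C : R) : measurable_fun setT g -> (forall x, `|g x| <= C) ->
  P2.-integrable setT (EFin \o (fun w => R2 w * g (X2 w))).
Proof.
move=> mg gC; apply: (@bounded_integrable _ _ _ P2 _ C).
  by apply: measurable_funM => //; exact: measurableT_comp.
move=> w; rewrite normrM -[leRHS]mul1r.
by apply: ler_pM.
Qed.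

Lemma same_expectationD g h : same_expectation g -> same_expectation h ->
  same_expectation (fun x => g x + h x).
Proof.
move=> [mg [C gC] eg] [mh [D hD] eh]; split.
- exact: measurable_funD.
- by exists (C + D) => x; rewrite (le_trans (ler_normD _ _))// lerD.
- transitivity (\int[P1]_w (R1 w * g (X1 w) + R1 w * h (X1 w)))%R.
    by apply: eq_Rintegral => w _; rewrite mulrDr.
  rewrite RintegralD//; [|exact: integrable1 gC|exact: integrable1 hD].
  rewrite eg eh -RintegralD//; [|exact: integrable2 gC|exact: integrable2 hD].
  by apply: eq_Rintegral => w _; rewrite mulrDr.
Qed.

Lemma same_expectationZ c g : same_expectation g -> same_expectation (fun x => c * g x).
Proof.
move=> [mg [C gC] eg]; split.
- exact: measurable_funM.
- by exists (`|c| * C) => x; rewrite normrM ler_wpM2l.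
- transitivity (\int[P1]_w (c * (R1 w * g (X1 w))))%R.
    by apply: eq_Rintegral => w _; rewrite mulrCA.
  rewrite RintegralZl//; [|exact: integrable1 gC].
  rewrite eg -RintegralZl//; [|exact: integrable2 gC].
  by apply: eq_Rintegral => w _; rewrite mulrCA.
Qed.

Lemma same_expectation_cst c : same_expectation (fun=> c).
Proof.
have := same_expectationZ c (Hcos 0 0); congr same_expectation.
by apply/funext => x; rewrite mul0r addr0 cos0 mulr1.
Qed.

Lemma same_expectation_cvg (g_ : nat -> R -> R) (g : R -> R) (C : R) :
  (forall n, same_expectation (g_ n)) -> (forall n x, `|g_ n x| <= C) ->
  (forall x, g_ n x @[n --> \oo] --> g x) -> same_expectation g.
Proof.
move=> Hg gC gcvg.
have mg_ n : measurable_fun setT (g_ n) by case: (Hg n).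
split.
- by apply: (measurable_fun_cvg mg_) => x _; exact: gcvg.
- exists C => x.
  have h : `|g_ n x| @[n --> \oo] --> `|g x| by apply: cvg_norm; exact: gcvg.
  rewrite -(cvg_lim _ h)//; apply: limr_le; first by apply/cvg_ex; exists `|g x|.
  by apply: nearW.
- have H1 := @bounded_cvg_Rintegral _ _ _ P1 (fun n w => R1 w * g_ n (X1 w))
    (fun w => R1 w * g (X1 w)) C.
  have H2 := @bounded_cvg_Rintegral _ _ _ P2 (fun n w => R2 w * g_ n (X2 w))
    (fun w => R2 w * g (X2 w)) C.
  apply: (cvg_unique _ (H1 _ _ _)) => //.
  + by move=> n; apply: measurable_funM => //; exact: measurableT_comp.
  + by move=> n x; rewrite normrM -[leRHS]mul1r ler_pM.
  + by move=> x; apply: cvgM; [exact: cvg_cst|exact: gcvg].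
  + rewrite (_ : (fun n => _) = (fun n => \int[P2]_w (R2 w * g_ n (X2 w)))%R); last first.
      by apply/funext => n; case: (Hg n).
    apply: H2.
    * by move=> n; apply: measurable_funM => //; exact: measurableT_comp.
    * by move=> n x; rewrite normrM -[leRHS]mul1r ler_pM.
    * by move=> x; apply: cvgM; [exact: cvg_cst|exact: gcvg].
Qed.

(* A Gaussian bump is a mixture of cosines, being its own Fourier transform. *)
Lemma same_expectation_bump s a :
  same_expectation (fun x => expR (- (s * (x - a)) ^+ 2 / 2)).
Proof.
have mb : measurable_fun setT (fun x : R => expR (- (s * (x - a)) ^+ 2 / 2)).
  apply: measurableT_comp => //; apply: measurable_funM => //.
  apply: measurableT_comp => //; apply: measurable_funX => //.
  by apply: measurable_funM => //; exact: measurable_funB.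
split=> //.
  exists 1 => x; rewrite ger0_norm ?expR_ge0// -[leRHS]expR0 ler_expR.
  by rewrite mulNr oppr_le0 mulr_ge0// sqr_ge0.
have key d (T : measurableType d) (P : probability T R) (X Rr : T -> R) :
    measurable_fun setT X -> measurable_fun setT Rr -> (forall w, `|Rr w| <= 1) ->
  (\int[P]_w (Rr w * expR (- (s * (X w - a)) ^+ 2 / 2)) =
   \int[N]_z \int[P]_w (Rr w * cos ((s * z) * X w + (- (s * z) * a))))%R.
  move=> mX mR bR.
  have mf : measurable_fun setT (fun wz : T * R =>
      Rr wz.1 * cos ((s * wz.2) * X wz.1 + (- (s * wz.2) * a))).
    have m1 : measurable_fun setT (fun wz : T * R => s * wz.2) by exact: measurable_funM.
    apply: measurable_funM; first exact: measurableT_comp.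
    apply: measurableT_comp; first exact: (continuous_measurable_fun (@continuous_cos R)).
    apply: measurable_funD.
      by apply: measurable_funM => //; exact: measurableT_comp.
    by apply: measurable_funM => //; exact: measurableT_comp.
  have bf (wz : T * R) : `|Rr wz.1 * cos ((s * wz.2) * X wz.1 + (- (s * wz.2) * a))| <= 1.
    by rewrite normrM -[leRHS]mul1r ler_pM// cos_max.
  have [<- _] := bounded_Fubini P N mf bf.
  apply: eq_Rintegral => w _ /=.
  have mc : measurable_fun setT (fun z : R => cos (s * (X w - a) * z)).
    apply: measurableT_comp; first exact: (continuous_measurable_fun (@continuous_cos R)).
    exact: measurable_funM.
  have [bc _] := @exp_bounded_bounded R (fun z => cos (s * (X w - a) * z)) (fun z => cos_max _).
  have [ic ec] := integral_normal01 mc bc.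
  rewrite -gE_cos -ec -RintegralZl//.
  by apply: eq_Rintegral => z _; congr (_ * cos _); ring.
rewrite (key _ _ P1)// (key _ _ P2)//.
by apply: eq_Rintegral => z _; have [_ _] := Hcos (s * z) (- (s * z) * a).
Qed.

(** The i-th power of a bump is a bump with [s] multiplied by the square root of i, so linearity
    suffices. *)
Lemma same_expectation_poly (p : {poly R}) s a :
  same_expectation (fun x => p.[expR (- (s * (x - a)) ^+ 2 / 2)]).
Proof.
under eq_fun do rewrite horner_coef.
have H (r : seq 'I_(size p)) : same_expectation (fun x =>
    \sum_(i <- r) p`_i * expR (- (s * (x - a)) ^+ 2 / 2) ^+ i).
  elim: r => [|i r IH].
    by under eq_fun do rewrite big_nil; exact: same_expectation_cst.
  under eq_fun do rewrite big_cons.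
  apply: same_expectationD => //; apply: same_expectationZ.
  have := same_expectation_bump (Num.sqrt i%:R * s) a; congr same_expectation.
  apply/funext => x; rewrite -expRM_natr -mulrA [in LHS]exprMn sqr_sqrtr ?ler0n//.
  by congr expR; ring.
exact: H.
Qed.

Lemma bernoulli_ineq (u : R) m : 0 <= u <= 1 -> 1 - m%:R * u <= (1 - u) ^+ m.
Proof.
move=> /andP[u0 u1]; elim: m => [|m IH]; first by rewrite mul0r subr0 expr0.
rewrite exprS; apply: (@le_trans _ _ ((1 - u) * (1 - m%:R * u))); last first.
  by rewrite ler_wpM2l// subr_ge0.
rewrite -natr1; have : 0 <= m%:R * u * u by rewrite !mulr_ge0.
by set t := m%:R; nra.
Qed.

Lemma cvg_natmul_exprn (q : R) : 0 < q < 1 -> n%:R * q ^+ n @[n --> \oo] --> 0.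
Proof.
move=> /andP[q0 q1].
(* Half of the decay e^(-hn) pays for the factor n, because n e^(-hn/2) <= 2/h; the other half tends
   to 0. *)
pose h := - ln q.
have h0 : 0 < h by rewrite oppr_gt0 ln_lt0// q0.
have qE : q = expR (- (h / 2)) * expR (- (h / 2)).
  rewrite -expRD /h -[LHS]lnK ?posrE//; congr expR; by field.
pose k := expR (- (h / 2)).
have k0 : 0 < k by exact: expR_gt0.
have k1 : k < 1 by rewrite expR_lt1 oppr_lt0 divr_gt0.
apply: (@squeeze_cvgr _ _ _ _ (fun=> 0) (fun n => (2 / h) * k ^+ n)).
- apply: nearW => n; apply/andP; split.
    by rewrite mulr_ge0// exprn_ge0// ltW.
  rewrite qE -/k exprMn mulrA ler_wpM2r//; first by rewrite exprn_ge0// ltW.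
  rewrite /k -expRM_natr mulNr expRN ler_pdivrMr ?expR_gt0//.
  have := expR_ge1Dx (h / 2 * n%:R) => H.
  apply: (@le_trans _ _ (2 / h * (h / 2 * n%:R))).
    by rewrite le_eqVlt; apply/orP; left; apply/eqP; field; rewrite gt_eqF.
  by rewrite ler_wpM2l ?divr_ge0 1?ltW//; lra.
- exact: cvg_cst.
- rewrite -(mulr0 (2 / h)); apply: cvgM; first exact: cvg_cst.
  by apply: cvg_expr; rewrite ger0_norm// ltW.
Qed.

(* For y in [0, 1], 1 - (1 - y^n)^(n 2^n) tends to 1 if y >= 1/2 and to 0 if
   y < 1/2, which turns Gaussian bumps into indicators of balls. *)
Lemma same_expectation_ball (a r : R) : 0 < r ->
  same_expectation (\1_[set x : R | `|x - a| <= r]).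
Proof.
move=> r0.
(* Makes the bump equal to 1/2 exactly at distance [r] from [a]. *)
pose s := Num.sqrt (2 * ln 2) / r.
pose g x := expR (- (s * (x - a)) ^+ 2 / 2).
pose p (n : nat) : {poly R} := 1 - (1 - 'X^n) ^+ (n * 2 ^ n).
have pE n y : (p n).[y] = 1 - (1 - y ^+ n) ^+ (n * 2 ^ n).
  by rewrite /p !hornerE.
have ln2 : 0 < ln 2 :> R by rewrite ln_gt0// ltr1n.
have gE x : (2^-1 <= g x) = (`|x - a| <= r).
  have r2 : 0 < r ^+ 2 by rewrite exprn_gt0.
  have -> : (`|x - a| <= r) = ((x - a) ^+ 2 <= r ^+ 2).
    rewrite -[in RHS](real_normK (num_real (x - a))) ler_sqr// nnegrE ?normr_ge0//.
    exact: ltW.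
  have -> : 2^-1 = expR (- ln 2) :> R by rewrite expRN lnK// posrE.
  rewrite /g ler_expR mulNr lerN2.
  have -> : (s * (x - a)) ^+ 2 / 2 = ln 2 * ((x - a) ^+ 2 / r ^+ 2).
    rewrite /s !exprMn sqr_sqrtr; last by rewrite mulr_ge0// ltW.
    by field; rewrite gt_eqF.
  by rewrite ger_pMr// ler_pdivrMr// mul1r.
apply: (@same_expectation_cvg (fun n x => (p n).[g x]) _ 1).
- by move=> n; exact: same_expectation_poly.
- move=> n x; rewrite pE.
  have g0 : 0 <= g x by exact: expR_ge0.
  have g1 : g x <= 1.
    by rewrite -[leRHS]expR0 ler_expR mulNr oppr_le0 mulr_ge0// sqr_ge0.
  have u0 : 0 <= g x ^+ n by rewrite exprn_ge0.
  have u1 : g x ^+ n <= 1 by rewrite exprn_ile1.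
  have v0 : 0 <= (1 - g x ^+ n) ^+ (n * 2 ^ n) by rewrite exprn_ge0 ?subr_ge0.
  have v1 : (1 - g x ^+ n) ^+ (n * 2 ^ n) <= 1.
    by rewrite exprn_ile1 ?subr_ge0// lerBlDr lerDl.
  by rewrite ger0_norm; lra.
- move=> x; under eq_fun do rewrite pE.
  have g0 : 0 < g x by exact: expR_gt0.
  have g1 : g x <= 1.
    by rewrite -[leRHS]expR0 ler_expR mulNr oppr_le0 mulr_ge0// sqr_ge0.
  have u0 n : 0 <= g x ^+ n by rewrite exprn_ge0// ltW.
  have u1 n : g x ^+ n <= 1 by rewrite exprn_ile1// ltW.
  rewrite indicE; have [gx|gx] := boolP (`|x - a| <= r).
    have -> : (x \in [set x0 | `|x0 - a| <= r])%:R = 1 - 0 :> R by rewrite mem_set// subr0.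
    apply: cvgB; first exact: cvg_cst.
    apply: (@squeeze_cvgr _ _ _ _ (fun=> 0) (fun n => expR (- n%:R))).
    - apply: nearW => n; rewrite exprn_ge0 ?subr_ge0//=.
      (* Inside the ball 2 g(x) >= 1, so the power is at most exp (- n (2 g(x))^n) <= exp (- n). *)
      have h1 : 1 - g x ^+ n <= expR (- g x ^+ n) by rewrite expR_ge1Dx.
      apply: (@le_trans _ _ (expR (- g x ^+ n) ^+ (n * 2 ^ n))).
        by rewrite lerXn2r ?nnegrE ?subr_ge0 ?expR_ge0.
      rewrite -expRM_natr ler_expR mulNr lerN2 natrM mulrCA.
      rewrite -[leLHS]mulr1 ler_wpM2l// natrX -exprMn exprn_ege1//.
      by move: gx; rewrite -gE; lra.
    - exact: cvg_cst.
    - exact: cvgn_expR.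
  have -> : (x \in [set x0 | `|x0 - a| <= r])%:R = 0 :> R by rewrite memNset//; exact/negP.
  apply: (@squeeze_cvgr _ _ _ _ (fun=> 0) (fun n => n%:R * (2 * g x) ^+ n)).
  - apply: nearW => n; rewrite subr_ge0 exprn_ile1 ?subr_ge0//=; last first.
      by rewrite lerBlDr lerDl.
    (* Outside the ball Bernoulli's inequality gives the bound n (2 g(x))^n, where 2 g(x) < 1. *)
    have := @bernoulli_ineq (g x ^+ n) (n * 2 ^ n); rewrite u0 u1 => /(_ isT).
    by rewrite natrM natrX exprMn mulrA; lra.
  - exact: cvg_cst.
  - apply: cvg_natmul_exprn; rewrite mulr_gt0//=.
    by move: gx; rewrite -gE -ltNge; lra.
Qed.

(** The ray is the increasing limit of the balls [a, a + 2(n+1)], which share their left end. *)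
Lemma same_expectation_ray (a : R) : same_expectation (\1_(`[a, +oo[%classic : set R)).
Proof.
apply: (@same_expectation_cvg (fun n => \1_[set x : R | `|x - (a + n.+1%:R)| <= n.+1%:R]) _ 1).
- by move=> n; apply: same_expectation_ball; rewrite ltr0n.
- by move=> n x; rewrite indicE; case: (_ \in _); rewrite /= ?normr1 ?normr0.
- move=> x; apply: cvg_near_cst; near=> n.
  rewrite !indicE; congr (_%:R); congr nat_of_bool.
  apply/idP/idP => /set_mem/= h; apply/mem_set => /=.
    by move: h; rewrite in_itv/= andbT ler_norml => /andP[]; lra.
  move: h; rewrite in_itv/= andbT => h.
  rewrite ler_norml; apply/andP; split; first by lra.
  suff : x - a <= n.+1%:R by lra.
  apply: (@le_trans _ _ n%:R); last by rewrite ler_nat.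
  by near: n; exact: nbhs_infty_ger.
Unshelve. all: by end_near. Qed.

(** Dynkin's theorem: the closed right rays are stable under intersection and generate the Borel
    sets. *)
Lemma same_expectation_indic (A : set R) : measurable A -> same_expectation (\1_A).
Proof.
move=> mA; have := mA; rewrite [measurable](RGenCInfty.measurableE R).
apply: (@dynkin_induction _ _ (@RGenCInfty.G R) (fun A => same_expectation (\1_A)) (RGenCInfty.measurableE R)).
- move=> _ _ [x ->] [y ->]; exists (Num.max x y).
  apply/seteqP; split=> z /=; rewrite !in_itv/= !andbT ge_max.
    by move=> [-> ->].
  by move=> /andP[-> ->].
- by have := same_expectation_cst 1; congr same_expectation; apply/funext => x; rewrite indicE in_setT.
- by move=> _ [x ->]; exact: same_expectation_ray.
- move=> S _ SS.
  have := same_expectationD (same_expectation_cst 1) (same_expectationZ (- 1) SS).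
  congr same_expectation; apply/funext => x; rewrite !indicE in_setC.
  by case: (_ \in _); rewrite /= ?mulr1 ?mulr0 ?subrr ?addr0.
- move=> F mF tF SF.
  (* By disjointness the partial sums at x jump once, from 0 to 1, or stay at 0. Hence they are
     bounded by 1 and eventually constant. *)
  have E x : (exists k, (\bigcup_n F n) x /\ forall n, \sum_(j < n) \1_(F j) x = (k < n)%N%:R :> R)
      \/ (~ (\bigcup_n F n) x /\ forall n, \sum_(j < n) \1_(F j) x = 0 :> R).
    have [[k _ Fk]|nF] := pselect ((\bigcup_n F n) x); [left; exists k|right]; split=> //.
    - by exists k.
    - have e j : \1_(F j) x = (j == k)%:R :> R.
        rewrite indicE; congr (nat_of_bool _)%:R; apply/idP/eqP => [/set_mem Fj|->]; last exact/mem_set.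
        by apply: (tF j k) => //; exists x.
      elim=> [|n IH]; first by rewrite big_ord0.
      rewrite big_ord_recr/= IH e -natrD ltnS; congr (_%:R).
      by case: ltngtP.
    - move=> n; apply: big1 => j _; rewrite indicE memNset// => Fj.
      by apply: nF; exists j.
  apply: (@same_expectation_cvg (fun n x => \sum_(k < n) \1_(F k) x) _ 1).
  + elim=> [|n IH].
      by under eq_fun do rewrite big_ord0; exact: same_expectation_cst.
    under eq_fun do rewrite big_ord_recr/=.
    exact: same_expectationD.
  + move=> n x; have [[k [_ ->]]|[_ ->]] := E x; last by rewrite normr0.
    by case: (k < n)%N; rewrite /= ?normr1 ?normr0.
  + move=> x; have [[k [Fx e]]|[Fx e]] := E x.
      apply: cvg_near_cst; near=> n; rewrite e indicE mem_set//.
      by rewrite (_ : (k < n)%N)//; near: n; exact: nbhs_infty_gt.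
    by apply: cvg_near_cst; apply: nearW => n; rewrite e indicE memNset.
Unshelve. all: by end_near. Qed.

End fourier_uniqueness.

(** * The product sigma-algebra and laws of families *)

Section path_space.
Context {R : realType}.

(** A list of one-coordinate constraints in which a coordinate may recur, so that intersecting
    cylinders is concatenating lists. *)
Fixpoint cylinder (J : Type) (D : seq (J * set R)) : set (J -> R) :=
  if D is k :: D' then [set x | k.2 (x k.1)] `&` cylinder D' else setT.

Fixpoint measurable_sides (J : Type) (D : seq (J * set R)) : Prop :=
  if D is k :: D' then measurable k.2 /\ measurable_sides D' else True.

Definition cylinders (J : Type) : set (set (J -> R)) :=
  [set B | exists2 D, measurable_sides D & B = cylinder D].

(** The product sigma-algebra for an arbitrary index type. Convergence of countably many polynomials
    is an event here, whatever coordinates they involve. *)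
Definition path_space (J : Type) := g_sigma_algebraType (@cylinders J).

Lemma cylinder_cat (J : Type) (D D' : seq (J * set R)) :
  cylinder (D ++ D') = cylinder D `&` cylinder D'.
Proof. by elim: D => [|k D IH] /=; rewrite ?setTI// IH setIA. Qed.

Lemma measurable_sides_cat (J : Type) (D D' : seq (J * set R)) :
  measurable_sides D -> measurable_sides D' -> measurable_sides (D ++ D').
Proof. by elim: D => [|k D IH] //= [mk mD] mD'; split=> //; exact: IH. Qed.

Lemma setI_closed_cylinders (J : Type) : setI_closed (@cylinders J).
Proof.
move=> _ _ [D mD ->] [D' mD' ->]; exists (D ++ D').
  exact: measurable_sides_cat.
by rewrite cylinder_cat.
Qed.

Lemma indic_cylinder (J : Type) (D : seq (J * set R)) (x : J -> R) :
  \1_(cylinder D) x = \prod_(k <- D) \1_(k.2) (x k.1) :> R.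
Proof.
elim: D => [|k D IH] /=; first by rewrite big_nil indicE in_setT.
rewrite big_cons -IH !indicE in_setI.
have -> : (x \in [set x0 | k.2 (x0 k.1)]) = (x k.1 \in k.2).
  by apply/idP/idP => /set_mem/= h; apply/mem_set.
by rewrite -natrM mulnb.
Qed.

Lemma measurable_coord (J : Type) (j : J) :
  measurable_fun setT (fun x : path_space J => x j).
Proof.
move=> _ A mA; rewrite setTI.
apply: sub_sigma_algebra; exists [:: (j, A)] => //=.
by rewrite setIT.
Qed.

Lemma measurable_cylinder (J : Type) (D : seq (J * set R)) : measurable_sides D ->
  measurable (cylinder D : set (path_space J)).
Proof. by move=> mD; apply: sub_sigma_algebra; exists D. Qed.

Lemma measurable_path (J : Type) d (T : measurableType d) (X : J -> T -> R) :
  (forall j, measurable_fun setT (X j)) ->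
  measurable_fun setT (fun w => (fun j => X j w) : path_space J).
Proof.
move=> mX.
apply: (@measurability _ _ T (path_space J) setT (fun w j => X j w) (@cylinders J) erefl).
move=> _ [_ [D mD ->] <-]; rewrite setTI.
elim: D mD => [|k D IH] /=; first by rewrite preimage_setT.
move=> [mk mD]; rewrite preimage_setI; apply: measurableI; last exact: IH.
by have := mX k.1 measurableT _ mk; rewrite setTI.
Qed.

Definition same_law (J : Type) d1 (T1 : measurableType d1) (P1 : probability T1 R)
    (X1 : J -> T1 -> R) d2 (T2 : measurableType d2) (P2 : probability T2 R)
    (X2 : J -> T2 -> R) :=
  forall B : set (path_space J), measurable B ->
    P1 ((fun w j => X1 j w) @^-1` B) = P2 ((fun w j => X2 j w) @^-1` B).

End path_space.

(** * The Cramer-Wold device *)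

Section same_law.
Context {R : realType} (J : Type) d1 (T1 : measurableType d1) (P1 : probability T1 R)
  d2 (T2 : measurableType d2) (P2 : probability T2 R).
Variables (X1 : J -> T1 -> R) (X2 : J -> T2 -> R).
Hypotheses (mX1 : forall j, measurable_fun setT (X1 j))
  (mX2 : forall j, measurable_fun setT (X2 j)).

Lemma same_law_integral (f : path_space J -> \bar R) : measurable_fun setT f ->
  same_law P1 X1 P2 X2 ->
  (\int[P1]_w f (fun j => X1 j w) = \int[P2]_w f (fun j => X2 j w))%E.
Proof.
move=> mf law.
have mp1 := measurable_path mX1; have mp2 := measurable_path mX2.
have H (g : path_space J -> \bar R) : measurable_fun setT g -> (forall x, 0 <= g x)%E ->
    (\int[P1]_w g (fun j => X1 j w) = \int[P2]_w g (fun j => X2 j w))%E.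
  move=> mg g0.
  transitivity (\int[pushforward P1 (fun w => (fun j => X1 j w) : path_space J)]_y g y)%E.
    by rewrite ge0_integral_pushforward.
  transitivity (\int[pushforward P2 (fun w => (fun j => X2 j w) : path_space J)]_y g y)%E.
    by apply: eq_measure_integral => A mA _; exact: law.
  by rewrite ge0_integral_pushforward.
rewrite integralE [RHS]integralE; congr (_ - _)%E.
- transitivity (\int[P1]_w f^\+ (fun j => X1 j w))%E.
    by apply: eq_integral => w _; rewrite !funeposE.
  rewrite (H _ (measurable_funepos mf) (funepos_ge0 _)).
  by apply: eq_integral => w _; rewrite !funeposE.
- transitivity (\int[P1]_w f^\- (fun j => X1 j w))%E.
    by apply: eq_integral => w _; rewrite !funenegE.
  rewrite (H _ (measurable_funeneg mf) (funeneg_ge0 _)).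
  by apply: eq_integral => w _; rewrite !funenegE.
Qed.

Hypothesis Hcos : forall (s : seq (R * J)) b,
  (\int[P1]_w cos (\sum_(k <- s) k.1 * X1 k.2 w + b) =
   \int[P2]_w cos (\sum_(k <- s) k.1 * X2 k.2 w + b))%R.

Let lin d (T : measurableType d) (X : J -> T -> R) (s : seq (R * J)) (w : T) :=
  \sum_(k <- s) k.1 * X k.2 w.
Let ind d (T : measurableType d) (X : J -> T -> R) (D : seq (J * set R)) (w : T) : R :=
  \prod_(k <- D) \1_(k.2) (X k.1 w).

Let mlin d (T : measurableType d) (X : J -> T -> R) s b :
  (forall j, measurable_fun setT (X j)) ->
  measurable_fun setT (fun w => cos (lin X s w + b)).
Proof.
move=> mX; apply: measurableT_comp; first exact: (continuous_measurable_fun (@continuous_cos R)).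
apply: measurable_funD => //; apply: measurable_sum => k.
exact: measurable_funM.
Qed.

Let mind d (T : measurableType d) (X : J -> T -> R) D :
  (forall j, measurable_fun setT (X j)) -> measurable_sides D ->
  measurable_fun setT (ind X D).
Proof.
move=> mX; elim: D => [_|k D IH /= [mk mD]].
  by rewrite (_ : ind X [::] = cst 1)//; apply/funext => w; rewrite /ind big_nil.
rewrite (_ : ind X _ = fun w => \1_(k.2) (X k.1 w) * ind X D w); last first.
  by apply/funext => w; rewrite /ind big_cons.
apply: measurable_funM; last exact: IH.
by apply: measurableT_comp.
Qed.

Let ind1 d (T : measurableType d) (X : J -> T -> R) D (w : T) : 0 <= ind X D w <= 1.
Proof.
by rewrite /ind -(indic_cylinder D (X ^~ w)) indicE; case: (_ \in _); rewrite /= ?lexx ?ler01.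
Qed.

(** Each induction step trades a cosine for an indicator in one coordinate: what concerns [D] and
    [s] becomes the weight in the one-dimensional uniqueness result. *)
Let cramer_wold_aux D : measurable_sides D -> forall s b,
  (\int[P1]_w (ind X1 D w * cos (lin X1 s w + b)) =
   \int[P2]_w (ind X2 D w * cos (lin X2 s w + b)))%R.
Proof.
elim: D => [_ s b|k D IH /= [mk mD] s b].
  transitivity (\int[P1]_w cos (lin X1 s w + b))%R.
    by apply: eq_Rintegral => w _; rewrite /ind big_nil mul1r.
  rewrite Hcos; apply: eq_Rintegral => w _; rewrite /ind big_nil mul1r//.
have mR1 : measurable_fun setT (fun w => ind X1 D w * cos (lin X1 s w + b)).
  by apply: measurable_funM; [exact: mind|exact: mlin].
have mR2 : measurable_fun setT (fun w => ind X2 D w * cos (lin X2 s w + b)).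
  by apply: measurable_funM; [exact: mind|exact: mlin].
have bR d (T : measurableType d) (X : J -> T -> R) t c w : `|ind X D w * cos (lin X t w + c)| <= 1.
  rewrite normrM -[leRHS]mul1r ler_pM ?cos_max//.
  by have /andP[h0 h1] := ind1 X D w; rewrite ger0_norm.
have intR d (T : measurableType d) (P : probability T R) (X : J -> T -> R) t c :
    (forall j, measurable_fun setT (X j)) ->
    P.-integrable setT (EFin \o (fun w => ind X D w * cos (lin X t w + c))).
  move=> mX; apply: (@bounded_integrable _ _ _ P _ 1) => //.
  by apply: measurable_funM; [exact: mind|exact: mlin].
(* The product formula for two cosines brings the extra cosine back to the form covered by the
   induction hypothesis, with a longer [s]. *)
have prodE d (T : measurableType d) (P : probability T R) (X : J -> T -> R) t c :
    (forall j, measurable_fun setT (X j)) ->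
  (\int[P]_w (ind X D w * cos (lin X s w + b) * cos (t * X k.1 w + c)) =
    2^-1 * (\int[P]_w (ind X D w * cos (lin X ((t, k.1) :: s) w + (b + c))) +
    \int[P]_w (ind X D w * cos (lin X ((- t, k.1) :: s) w + (b - c)))))%R.
  move=> mX; rewrite -RintegralD//; [|exact: intR|exact: intR].
  rewrite -RintegralZl//; last exact: (integrableD measurableT (intR _ _ _ _ _ _ mX) (intR _ _ _ _ _ _ mX)).
  apply: eq_Rintegral => w _; rewrite /lin !big_cons/=.
  have -> : t * X k.1 w + \sum_(j <- s) j.1 * X j.2 w + (b + c) =
    (\sum_(j <- s) j.1 * X j.2 w + b) + (t * X k.1 w + c) by ring.
  have -> : - t * X k.1 w + \sum_(j <- s) j.1 * X j.2 w + (b - c) =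
    (\sum_(j <- s) j.1 * X j.2 w + b) - (t * X k.1 w + c) by ring.
  move: (\sum_(j <- s) _ + b) (t * X k.1 w + c) => A B.
  by rewrite cosD cosB; field.
have Hc t c : same_expectation P1 P2 (X1 k.1) (X2 k.1)
    (fun w => ind X1 D w * cos (lin X1 s w + b)) (fun w => ind X2 D w * cos (lin X2 s w + b))
    (fun x => cos (t * x + c)).
  split.
  - apply: measurableT_comp; first exact: (continuous_measurable_fun (@continuous_cos R)).
    by apply: measurable_funD => //; exact: measurable_funM.
  - by exists 1 => x; exact: cos_max.
  - by rewrite !prodE// !IH.
have [_ _ H] := same_expectation_indic (mX1 k.1) (mX2 k.1) mR1 mR2 (bR _ _ X1 s b)
  (bR _ _ X2 s b) Hc mk.
transitivity (\int[P1]_w (ind X1 D w * cos (lin X1 s w + b) * \1_(k.2) (X1 k.1 w)))%R.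
  by apply: eq_Rintegral => w _; rewrite [in LHS]/ind big_cons -/(ind X1 D w); ring.
by rewrite H; apply: eq_Rintegral => w _; rewrite [in RHS]/ind big_cons -/(ind X2 D w); ring.
Qed.

(** The two image measures agree on cylinders, a generating class stable under intersection. *)
Theorem cramer_wold : same_law P1 X1 P2 X2.
Proof.
have mp1 := measurable_path mX1; have mp2 := measurable_path mX2.
move=> B mB.
pose m1 := pushforward P1 (fun w => (fun j => X1 j w) : path_space J).
pose m2 := pushforward P2 (fun w => (fun j => X2 j w) : path_space J).
have H : forall A, cylinders A -> m1 A = m2 A.
  move=> _ [D mD ->]; rewrite /m1 /m2 /pushforward.
  have := cramer_wold_aux mD [::] 0.
  have E d (T : measurableType d) (P : probability T R) (X : J -> T -> R) :
    (forall j, measurable_fun setT (X j)) ->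
    (\int[P]_w (ind X D w * cos (lin X [::] w + 0)) = fine (P ((fun w j => X j w) @^-1` cylinder D)))%R.
    move=> mX; have mC := measurable_path mX measurableT (measurable_cylinder mD).
    rewrite setTI in mC.
    have := integral_indic P measurableT mC; rewrite setIT => <-.
    congr fine; apply: eq_integral => w _; rewrite /lin big_nil addr0 cos0 mulr1.
    by rewrite /ind -(indic_cylinder D (X ^~ w)).
  rewrite !E// => e.
  have mC1 := mp1 measurableT _ (measurable_cylinder mD); rewrite setTI in mC1.
  have mC2 := mp2 measurableT _ (measurable_cylinder mD); rewrite setTI in mC2.
  by rewrite -[LHS]fineK ?fin_num_measure// -[RHS]fineK ?fin_num_measure// e.
apply: (@measure_unique _ _ (path_space J) (@cylinders R J) (fun=> setT) erefl (@setI_closed_cylinders R J) _ _ m1 m2 H _ B mB).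
- by move=> i; exists [::].
- by rewrite bigcup_const//; exists 0%N.
- exact: mp2.
- move=> k; apply: (@eq_ind _ _ (fun x => (x < +oo)%E) (ltry 1) (m1 setT)).
  by rewrite -(probability_setT P1).
Qed.

End same_law.

Section standard_normal.
Context {R : realType} d (T : measurableType d) (P : probability T R).
Local Notation phi := (normal_pdf (0 : R) 1).

Lemma standard_normal_integral (Z : T -> R) (f : R -> R) : measurable_fun setT Z ->
  (forall A, measurable A -> P (Z @^-1` A) = normal_prob 0 1 A) ->
  measurable_fun setT f -> exp_bounded f ->
  P.-integrable setT (EFin \o (f \o Z)) /\
  (\int[P]_w f (Z w) = \int[lebesgue_measure]_x (f x * phi x))%R.
Proof.
move=> mZ lawZ mf bf.
have [iN eN] := integral_normal01 mf bf.
have mZ' : measurable_fun setT (Z : T -> measurableTypeR R) by [].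
have H (g : measurableTypeR R -> \bar R) : measurable_fun setT g -> (forall x, 0 <= g x)%E ->
    (\int[P]_w g (Z w) = \int[normal_prob 0 1]_x g x)%E.
  move=> mg g0.
  transitivity (\int[pushforward P (Z : T -> measurableTypeR R)]_x g x)%E.
    by rewrite ge0_integral_pushforward.
  by apply: eq_measure_integral => A mA _; exact: lawZ.
have mf' : measurable_fun setT (EFin \o f : measurableTypeR R -> \bar R).
  exact/measurable_EFinP.
split.
  apply/integrableP; split; first by apply/measurable_EFinP; exact: measurableT_comp.
  rewrite (H (fun x => `|(f x)%:E|)%E)//; last exact: measurableT_comp.
  by have [_] := integrableP _ _ _ iN.
rewrite -eN; congr fine.
rewrite integralE [RHS]integralE; congr (_ - _)%E.
- rewrite -(H _ (measurable_funepos mf') (funepos_ge0 _)).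
  by apply: eq_integral => w _; rewrite !funeposE.
- rewrite -(H _ (measurable_funeneg mf') (funeneg_ge0 _)).
  by apply: eq_integral => w _; rewrite !funenegE.
Qed.

End standard_normal.

(** * Rotation invariance of Gaussian families *)

Section inner_product.
Context {R : realType} {H : normedModType R} (ip : H -> H -> R).
Hypothesis Hip : is_inner_product ip.

Lemma inner_product_suml (s : seq (R * H)) z :
  ip (\sum_(k <- s) k.1 *: k.2) z = \sum_(k <- s) k.1 * ip k.2 z.
Proof.
have [_ lin _] := Hip.
have ip0 : ip 0 z = 0.
  by have := lin 1 0 0 z; rewrite scaler0 addr0 mul1r => /eqP; rewrite -subr_eq0 opprD addNKr oppr_eq0 => /eqP.
elim: s => [|k s IH]; first by rewrite !big_nil.
by rewrite !big_cons lin IH.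
Qed.

(** The double sum is the squared norm of the linear combination. *)
Lemma gram_ge0 (s : seq (R * H)) :
  0 <= \sum_(j <- s) \sum_(k <- s) j.1 * k.1 * ip j.2 k.2.
Proof.
have [sym _ nrm] := Hip.
suff -> : \sum_(j <- s) \sum_(k <- s) j.1 * k.1 * ip j.2 k.2 =
    ip (\sum_(k <- s) k.1 *: k.2) (\sum_(k <- s) k.1 *: k.2).
  by rewrite nrm sqr_ge0.
rewrite inner_product_suml; apply: eq_bigr => j _.
rewrite sym inner_product_suml mulr_sumr; apply: eq_bigr => k _.
by rewrite mulrA sym.
Qed.

End inner_product.

Section isonormal_law.
Context {R : realType} {H : normedModType R} (ip : H -> H -> R)
  (Hip : is_inner_product ip) (I : eqType) (e : I -> H)
  (ortho : forall i j, ip (e i) (e j) = (i == j)%:R)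
  d (Omega : measurableType d) (P : probability Omega R)
  (W : H -> Omega -> R) (HW : isonormal ip P W).
Local Notation phi := (normal_pdf (0 : R) 1).

Lemma isonormal_standard (s : seq (R * H)) :
  let v := \sum_(j <- s) \sum_(k <- s) j.1 * k.1 * ip j.2 k.2 in
  v = 1 -> forall A, measurable A ->
  P ((fun w => \sum_(k <- s) k.1 * W k.2 w) @^-1` A) = normal_prob 0 1 A.
Proof.
move=> v v1 A mA; have [_ law] := HW.
by rewrite law// -/v v1 /centered_normal_law oner_eq0 sqrtr1.
Qed.

Lemma measurable_isonormal_sum (s : seq (R * H)) :
  measurable_fun setT (fun w => \sum_(k <- s) k.1 * W k.2 w).
Proof.
have [mW _] := HW.
by apply: measurable_sum => k; exact: measurable_funM.
Qed.

Lemma isonormal_cos (s : seq (R * H)) b :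
  (\int[P]_w cos (\sum_(k <- s) k.1 * W k.2 w + b) =
  cos b * expR (- (\sum_(j <- s) \sum_(k <- s) j.1 * k.1 * ip j.2 k.2) / 2))%R.
Proof.
set v := \sum_(j <- s) _.
have mcos c t : measurable_fun setT (fun x : R => cos (t * x + c)).
  apply: measurableT_comp; first exact: (continuous_measurable_fun (@continuous_cos R)).
  by apply: measurable_funD => //; exact: measurable_funM.
have v0 : 0 <= v by exact: gram_ge0 Hip _.
have [mW law] := HW.
(* In the degenerate case the law is a point mass, and the combination vanishes almost surely. *)
have [ve|vn] := eqVneq v 0.
  rewrite ve oppr0 mul0r expR0 mulr1.
  pose Y w := \sum_(k <- s) k.1 * W k.2 w.
  have mY : measurable_fun setT Y by exact: measurable_isonormal_sum.
  transitivity (\int[P]_w cos b)%R; last first.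
    by rewrite Rintegral_cst//= probability_setT mulr1.
  congr fine; apply: ae_eq_integral => //.
    apply/measurable_EFinP; have := measurableT_comp (mcos b 1) mY.
    by apply: eq_measurable_fun => w _ /=; rewrite mul1r.
  exists (Y @^-1` [set~ 0]); split.
  - by have := mY measurableT [set~ 0]; rewrite setTI; apply; exact: measurableC.
  - have /= := law s [set~ 0] (measurableC (measurable_set1 0)).
    by rewrite -/v /centered_normal_law ve eqxx => ->; rewrite diracE memNset//; apply.
  - move=> w /= h Yw; apply: h => _; rewrite -/(Y w) Yw add0r//.
have v1 : 0 < v by rewrite lt_neqAle eq_sym vn.
(* Normalization to unit variance; the scale reappears as the frequency sqrt v of the cosine. *)
pose s' := [seq (k.1 / Num.sqrt v, k.2) | k <- s].
have sv0 : Num.sqrt v != 0 by rewrite gt_eqF// sqrtr_gt0.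
have e1 : \sum_(j <- s') \sum_(k <- s') j.1 * k.1 * ip j.2 k.2 = 1.
  transitivity (v * (Num.sqrt v) ^- 2); last by rewrite sqr_sqrtr// mulfV.
  rewrite big_map mulr_suml; apply: eq_bigr => j _.
  rewrite big_map mulr_suml; apply: eq_bigr => k _ /=.
  by field.
have [_] := standard_normal_integral (measurable_isonormal_sum s')
  (isonormal_standard e1) (mcos b (Num.sqrt v))
  (@exp_bounded_bounded R (fun x => cos (Num.sqrt v * x + b)) (fun x => cos_max _)).1.
rewrite gE_cosD sqr_sqrtr// => <-; apply: eq_Rintegral => w _.
congr (cos (_ + _)); rewrite big_map mulr_sumr; apply: eq_bigr => k _ /=.
by field.
Qed.

(** Coefficients and coordinates may vary with [j]. This covers rotations, pairs of rotated copies,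
    and the replacement of a single coordinate by its independent copy. *)
Definition gaussian_pair (J : Type) (a : J -> R) (i : J -> I) (a' : J -> R) (i' : J -> I)
    (j : J) (w : Omega * Omega) : R :=
  a j * W (e (i j)) w.1 + a' j * W (e (i' j)) w.2.

(** The covariance of the entries [j] and [k] of [gaussian_pair]. *)
Definition gaussian_gram (J : Type) (a : J -> R) (i : J -> I) (a' : J -> R) (i' : J -> I)
    (j k : J) : R :=
  a j * a k * (i j == i k)%:R + a' j * a' k * (i' j == i' k)%:R.

Lemma measurable_gaussian_pair (J : Type) a i a' i' (j : J) :
  measurable_fun setT (gaussian_pair a i a' i' j).
Proof.
have [mW _] := HW.
by apply: measurable_funD; apply: measurable_funM => //; exact: measurableT_comp.
Qed.

(** In the inner integral of Fubini's theorem the first copy is only a phase. The two Gaussian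
    factors then multiply, which adds the covariances. *)
Lemma gaussian_pair_cos (J : Type) a i a' i' (s : seq (R * J)) b :
  (\int[(P \x P)%E]_w cos (\sum_(k <- s) k.1 * gaussian_pair a i a' i' k.2 w + b) =
  cos b * expR (- (\sum_(j <- s) \sum_(k <- s)
    j.1 * k.1 * gaussian_gram a i a' i' j.2 k.2) / 2))%R.
Proof.
pose f (w : Omega * Omega) := cos (\sum_(k <- s) k.1 * gaussian_pair a i a' i' k.2 w + b).
have mf : measurable_fun setT f.
  apply: measurableT_comp; first exact: (continuous_measurable_fun (@continuous_cos R)).
  apply: measurable_funD => //; apply: measurable_sum => k; apply: measurable_funM => //.
  exact: measurable_gaussian_pair.
have [_ <-] := bounded_Fubini P P mf (fun w => cos_max _).
pose t := [seq (k.1 * a k.2, e (i k.2)) | k <- s].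
pose t' := [seq (k.1 * a' k.2, e (i' k.2)) | k <- s].
have fE w w' : f (w, w') = cos (\sum_(k <- t') k.1 * W k.2 w' + (\sum_(k <- t) k.1 * W k.2 w + b)).
  rewrite /f /t /t' !big_map addrA -big_split/=; congr (cos (_ + b)).
  by apply: eq_bigr => k _; rewrite /gaussian_pair/=; ring.
transitivity (\int[P]_w (cos (\sum_(k <- t) k.1 * W k.2 w + b) *
    expR (- (\sum_(j <- t') \sum_(k <- t') j.1 * k.1 * ip j.2 k.2) / 2)))%R.
  apply: eq_Rintegral => w _; rewrite -isonormal_cos.
  by apply: eq_Rintegral => w' _; rewrite fE.
rewrite RintegralZr//; last first.
  apply: (@bounded_integrable _ _ _ P _ 1); last by move=> w; exact: cos_max.
  apply: measurableT_comp; first exact: (continuous_measurable_fun (@continuous_cos R)).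
  by apply: measurable_funD => //; exact: measurable_isonormal_sum.
rewrite isonormal_cos -mulrA -expRD; congr (_ * expR _).
rewrite -mulrDl -opprD; congr (- _ / _).
rewrite /t /t' !big_map -big_split/=; apply: eq_bigr => j _.
rewrite !big_map -big_split/=; apply: eq_bigr => k _.
by rewrite !ortho /gaussian_gram; ring.
Qed.

Lemma gaussian_pair_same_law (J : Type) a i a' i' b k b' k' :
  (forall j l : J, gaussian_gram a i a' i' j l = gaussian_gram b k b' k' j l) ->
  same_law (P \x P)%E (gaussian_pair a i a' i') (P \x P)%E (gaussian_pair b k b' k').
Proof.
move=> E; apply: cramer_wold.
- by move=> j; exact: measurable_gaussian_pair.
- by move=> j; exact: measurable_gaussian_pair.
- move=> s c; rewrite (gaussian_pair_cos a i a' i' s c) (gaussian_pair_cos b k b' k' s c).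
  under eq_bigr do under eq_bigr do rewrite E.
  by [].
Qed.

Lemma gaussian_pair_same_law1 a i a' i' :
  (forall j l : I, gaussian_gram a i a' i' j l = (j == l)%:R) ->
  same_law (P \x P)%E (gaussian_pair a i a' i') P (fun j => W (e j)).
Proof.
have [mW _] := HW.
move=> E; apply: cramer_wold => //.
- by move=> j; exact: measurable_gaussian_pair.
- move=> s c; rewrite (gaussian_pair_cos a i a' i' s c).
  transitivity (\int[P]_w cos (\sum_(k <- [seq (k.1, e k.2) | k <- s]) k.1 * W k.2 w + c))%R.
    rewrite isonormal_cos.
    under eq_bigr do under eq_bigr do rewrite E -ortho.
    by rewrite big_map; under [in RHS]eq_bigr do rewrite big_map.
  by apply: eq_Rintegral => w _; rewrite big_map.
Qed.

End isonormal_law.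

(** The weights are coefficients of the Lagrange basis, hence independent of [Q]. They serve twice:
    for a value on the circle and to extract one chaos component from Mehler's formula. *)
Lemma interpolation (R : realType) (v : nat -> R) (n k : nat) : injective v ->
  exists l : 'I_n -> R, forall Q : {poly R}, (size Q <= n)%N ->
    Q`_k = \sum_(j < n) l j * Q.[v j].
Proof.
move=> vinj; case: n => [|n].
  exists (fun=> 0) => Q; rewrite leqn0 size_poly_eq0 => /eqP ->.
  by rewrite big_ord0 coef0.
exists (fun j => (tnth (qpoly.lagrange n.+1 v) j : {poly R})`_k) => Q sQ.
rewrite {1}(qpoly.lagrange_gen (isT : (0 < n.+1)%N) vinj sQ) coef_sum.
by apply: eq_bigr => j _; rewrite mul_polyC coefZ mulrC.
Qed.

(** * Polynomials in a Gaussian family *)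

Section polyfun.
Context {R : realType} (I : Type).

(** Polynomials of degree at most n in arbitrarily many variables. The inductive form lets moments,
    measurability and restriction to a circle be proved without monomials. *)
Inductive polyfun : nat -> ((I -> R) -> R) -> Prop :=
| polyfun_cst c : polyfun 0 (fun=> c)
| polyfun_coord i : polyfun 1 (fun x => x i)
| polyfun_add n f g : polyfun n f -> polyfun n g -> polyfun n (fun x => f x + g x)
| polyfun_mul m n f g : polyfun m f -> polyfun n g -> polyfun (m + n) (fun x => f x * g x)
| polyfun_leq m n f : (m <= n)%N -> polyfun m f -> polyfun n f.

Lemma polyfun_scale n c f : polyfun n f -> polyfun n (fun x => c * f x).
Proof. by move=> pf; exact: (polyfun_mul (polyfun_cst c) pf). Qed.

Lemma polyfun_sub n f g : polyfun n f -> polyfun n g -> polyfun n (fun x => f x - g x).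
Proof.
move=> pf pg; rewrite (_ : (fun x => _) = fun x => f x + (- 1) * g x).
  by apply: polyfun_add => //; exact: polyfun_scale.
by apply/funext => x; rewrite mulN1r.
Qed.

Lemma polyfun_sum n (K : Type) (s : seq K) (f : K -> (I -> R) -> R) :
  (forall k, polyfun n (f k)) -> polyfun n (fun x => \sum_(k <- s) f k x).
Proof.
move=> pf; elim: s => [|k s IH].
  rewrite (_ : (fun x => _) = fun=> 0); last by apply/funext => x; rewrite big_nil.
  exact: polyfun_leq (polyfun_cst 0).
rewrite (_ : (fun x => _) = fun x => f k x + \sum_(k <- s) f k x).
  exact: polyfun_add.
by apply/funext => x; rewrite big_cons.
Qed.

Lemma polyfun_prod (K : Type) (s : seq K) (n : K -> nat) (f : K -> (I -> R) -> R) :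
  (forall k, polyfun (n k) (f k)) ->
  polyfun (\sum_(k <- s) n k) (fun x => \prod_(k <- s) f k x).
Proof.
move=> pf; elim: s => [|k s IH].
  rewrite (_ : (fun x => _) = fun=> 1); last by apply/funext => x; rewrite big_nil.
  by rewrite big_nil; exact: polyfun_cst.
rewrite (_ : (fun x => _) = fun x => f k x * \prod_(k <- s) f k x).
  by rewrite big_cons; exact: polyfun_mul.
by apply/funext => x; rewrite big_cons.
Qed.

Lemma polyfun_horner (p : {poly R}) i : polyfun (size p).-1 (fun x => p.[x i]).
Proof.
rewrite (_ : (fun x => _) = fun x => \sum_(k < size p) p`_k * x i ^+ k); last first.
  by apply/funext => x; rewrite horner_coef.
have pX k : polyfun k (fun x => x i ^+ k).
  elim: k => [|k IH].
    by rewrite (_ : (fun x => _) = fun=> 1)//; exact: polyfun_cst.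
  rewrite (_ : (fun x => _) = fun x => x i * x i ^+ k).
    exact: (polyfun_mul (polyfun_coord i) IH).
  by apply/funext => x; rewrite exprS.
apply: polyfun_sum => k; apply: polyfun_scale.
by apply: polyfun_leq (pX k); case: (size p) k => [[]//|m] k; rewrite -ltnS.
Qed.

Lemma polyfun_affine n f x y (a : I -> R) : polyfun n f ->
  polyfun n (fun z => f (fun i => x * a i + y * z i)).
Proof.
elim=> {n f} [c|i|n f g _ pf _ pg|m n f g _ pf _ pg|m n f mn _ pf].
- exact: polyfun_cst.
- apply: polyfun_add; first exact: polyfun_leq (polyfun_cst _).
  exact/polyfun_scale/polyfun_coord.
- exact: polyfun_add.
- exact: polyfun_mul.
- exact: polyfun_leq pf.
Qed.

Lemma measurable_polyfun n f : polyfun n f -> measurable_fun setT (f : path_space I -> R).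
Proof.
elim=> {n f} [c|i|n f g _ pf _ pg|m n f g _ pf _ pg|m n f mn _ pf] //.
- exact: measurable_coord.
- exact: measurable_funD.
- exact: measurable_funM.
Qed.

End polyfun.

(** * Rational parametrization of the circle and interpolation *)

Section rotation_parametrization.
Context {R : realType}.

(** Cosine and sine in terms of u = tan(theta/2), so that trigonometric polynomials become ordinary
    ones up to a power of 1 + u^2. *)
Definition circ_x (u : R) := (1 - u ^+ 2) / (1 + u ^+ 2).
Definition circ_y (u : R) := (2 * u) / (1 + u ^+ 2).

Lemma circ_den_gt0 (u : R) : 0 < 1 + u ^+ 2.
Proof. by rewrite ltr_pwDl// sqr_ge0. Qed.

Lemma circ_unit (u : R) : circ_x u ^+ 2 + circ_y u ^+ 2 = 1.
Proof.
by rewrite /circ_x /circ_y; field; rewrite gt_eqF// circ_den_gt0.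
Qed.

Lemma circ_x_inj : {in Num.nneg &, injective circ_x}.
Proof.
move=> u v; rewrite !nnegrE => u0 v0; rewrite /circ_x => e.
have u1 := circ_den_gt0 u; have v1 := circ_den_gt0 v.
have {}e : (1 - u ^+ 2) * (1 + v ^+ 2) = (1 - v ^+ 2) * (1 + u ^+ 2).
  have du : 1 + u ^+ 2 != 0 by rewrite gt_eqF.
  have dv : 1 + v ^+ 2 != 0 by rewrite gt_eqF.
  by move/eqP: e; rewrite (eqr_div _ _ du dv) => /eqP.
have : u ^+ 2 = v ^+ 2 by lra.
by move=> /eqP; rewrite eqrXn2// => /eqP.
Qed.

(** The factor (1 + u^2)^n clears the denominators; the degree 2n in u explains the 2n + 1 nodes. *)
Lemma polyfun_circ (I : Type) n (f : (I -> R) -> R) (a b : I -> R) : polyfun n f ->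
  exists Q : {poly R}, (size Q <= n.*2.+1)%N /\
    forall u, Q.[u] = (1 + u ^+ 2) ^+ n * f (fun i => circ_x u * a i + circ_y u * b i).
Proof.
elim=> {n f} [c|i|n f g _ [Q [sQ EQ]] _ [S [sS ES]]|m n f g _ [Q [sQ EQ]] _ [S [sS ES]]|m n f mn _ [Q [sQ EQ]]].
- exists c%:P; split; first by rewrite size_polyC; case: (c != 0).
  by move=> u; rewrite hornerC expr0 mul1r.
- exists (a i *: (1 - 'X^2) + (2 * b i) *: 'X); split.
    apply: (leq_trans (size_polyD _ _)); rewrite geq_max; apply/andP; split.
      apply: (leq_trans (size_scale_leq _ _)); apply: (leq_trans (size_polyD _ _)).
      by rewrite size_polyN size_polyXn size_poly1.
    by apply: (leq_trans (size_scale_leq _ _)); rewrite size_polyX.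
  move=> u; rewrite !hornerE /circ_x /circ_y; field.
  by rewrite gt_eqF// circ_den_gt0.
- exists (Q + S); split.
    by apply: (leq_trans (size_polyD _ _)); rewrite geq_max sQ sS.
  by move=> u; rewrite hornerD EQ ES mulrDr.
- exists (Q * S); split.
    apply: (leq_trans (size_polyMleq _ _)).
    by rewrite doubleD; move: sQ sS; case: (size Q) (size S) => [|a1] [|b1]; lia.
  by move=> u; rewrite hornerM EQ ES exprD; ring.
(* Weakening the degree bound costs further factors of the denominator. *)
- exists (Q * (1 + 'X^2) ^+ (n - m)); split.
    apply: (leq_trans (size_polyMleq _ _)).
    have : (size ((1 + 'X^2 : {poly R}) ^+ (n - m)) <= (n - m).*2.+1)%N.
      apply: (leq_trans (size_poly_exp_leq _ _)).
      have : (size ((1 + 'X^2)%R : {poly R}) <= 3)%N.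
        by apply: (leq_trans (size_polyD _ _)); rewrite size_polyXn size_poly1.
      by case: (size _) => [|[|[|[|]]]]//=; lia.
    by move: sQ; case: (size Q) (size _) => [|a1] [|b1]; lia.
  move=> u; rewrite hornerM EQ -[in RHS](subnK mn) exprD !hornerE.
  by rewrite -mulrA mulrC.
Qed.

(* The points of the circle with parameters [circ_pt true j] and [circ_pt false j]
   are orthogonal, so they send (xi, xi') to another pair of independent copies. *)
Definition circ_pt (b : bool) (j : nat) : R :=
  let u := (j.+2%:R)^-1 in if b then (1 + u) / (1 - u) else u.

Let u_bounds (j : nat) : 0 < (j.+2%:R : R)^-1 < 1.
Proof. by rewrite invr_gt0 ltr0n invf_lt1 ?ltr0n// ltr1n. Qed.

(** If u = tan(theta/2), then (1 + u)/(1 - u) = tan(theta/2 + pi/4): the second point is a quarter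
    turn ahead. *)
Lemma circ_pt_x j : circ_x (circ_pt true j) = - circ_y (circ_pt false j).
Proof.
rewrite /circ_pt; have /andP[] := u_bounds j; set u := (_^-1) => u0 u1.
have d0 := circ_den_gt0 u.
have d1 : (1 - u) ^+ 2 + (1 + u) ^+ 2 = 2 * (1 + u ^+ 2) by ring.
rewrite /circ_x /circ_y; field.
by rewrite d1 !gt_eqF ?mulr_gt0// subr_gt0.
Qed.

Lemma circ_pt_y j : circ_y (circ_pt true j) = circ_x (circ_pt false j).
Proof.
rewrite /circ_pt; have /andP[] := u_bounds j; set u := (_^-1) => u0 u1.
have d0 := circ_den_gt0 u.
have d1 : (1 - u) ^+ 2 + (1 + u) ^+ 2 = 2 * (1 + u ^+ 2) by ring.
rewrite /circ_x /circ_y; field.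
by rewrite d1 !gt_eqF ?mulr_gt0// subr_gt0.
Qed.

(** The nodes must be distinct for every selection [s]. Parameters of one kind lie in (0, 1), those
    of the other exceed 1, and each kind is injective in [j]. *)
Lemma circ_pt_inj (s : nat -> bool) : injective (fun j => circ_pt (s j) j).
Proof.
have uinj (i j : nat) : (i.+2%:R)^-1 = (j.+2%:R)^-1 :> R -> i = j.
  by move/invr_inj/eqP; rewrite eqr_nat !eqSS => /eqP.
move=> i j; rewrite /circ_pt.
have /andP[] := u_bounds i; set u := (_^-1) => u0 u1.
have /andP[] := u_bounds j; set v := (_^-1) => v0 v1.
have gt1 (x : R) : 0 < x -> x < 1 -> 1 < (1 + x) / (1 - x).
  by move=> x0 x1; rewrite ltr_pdivlMr ?subr_gt0//; lra.
case: (s i) (s j) => -[] e.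
- apply: uinj; rewrite -/u -/v.
  have du : 1 - u != 0 by rewrite gt_eqF// subr_gt0.
  have dv : 1 - v != 0 by rewrite gt_eqF// subr_gt0.
  by move/eqP: e; rewrite (eqr_div _ _ du dv) => /eqP; lra.
- by exfalso; move: (gt1 _ u0 u1); rewrite e; lra.
- by exfalso; move: (gt1 _ v0 v1); rewrite -e; lra.
- exact: uinj.
Qed.

(** The selection of nodes depends on [f], [a] and [b], but only finitely many selections exist;
    summing their interpolation constants gives a [C] depending on [q] alone. *)
Lemma polyfun_interpolation_bound (q : nat) : exists C : R, 0 < C /\
  forall (I : Type) (f : (I -> R) -> R) (a b : I -> R) (t : R), polyfun q f -> 0 <= t ->
  (forall j, (j < q.*2.+1)%N -> exists s,
     `|f (fun i => circ_x (circ_pt s j) * a i + circ_y (circ_pt s j) * b i)| <= t) ->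
  `|f a| <= C * t.
Proof.
pose n := q.*2.+1.
(* Interpolation takes a sequence of nodes indexed by all integers; beyond n the value [false] is
   arbitrary. *)
pose ext (s : {ffun 'I_n -> bool}) (j : nat) := if insub j is Some i then s i else false.
have extE s (i : 'I_n) : ext s i = s i by rewrite /ext valK.
have /choice[l Hl] : forall s : {ffun 'I_n -> bool}, exists l : 'I_n -> R,
    forall Q : {poly R}, (size Q <= n)%N ->
    Q`_0 = \sum_(j < n) l j * Q.[circ_pt (ext s j) j].
  by move=> s; exact: (interpolation n 0 (@circ_pt_inj (ext s))).
pose D s := \sum_(j < n) `|l s j| * (1 + circ_pt (ext s j) j ^+ 2) ^+ q.
have D0 s : 0 <= D s.
  by apply: sumr_ge0 => j _; rewrite mulr_ge0// exprn_ge0// ltW// circ_den_gt0.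
exists (\sum_s D s + 1); split; first by rewrite ltr_wpDl// sumr_ge0.
move=> I f a b t pf t0 Hs.
have [s Es] : exists s : {ffun 'I_n -> bool}, forall j : 'I_n,
    `|f (fun i => circ_x (circ_pt (s j) j) * a i + circ_y (circ_pt (s j) j) * b i)| <= t.
  have /choice[s Es] : forall j : 'I_n, exists s,
     `|f (fun i => circ_x (circ_pt s j) * a i + circ_y (circ_pt s j) * b i)| <= t.
    by move=> j; exact: Hs.
  by exists [ffun j => s j] => j; rewrite ffunE.
have [Q [sQ EQ]] := polyfun_circ a b pf.
(* The parameter u = 0 is the angle 0, that is the point [a] itself. *)
have fa : f a = Q`_0.
  rewrite -horner_coef0 EQ expr0n/= addr0 expr1n mul1r; congr f; apply/funext => i.
  by rewrite /circ_x /circ_y expr0n/= subr0 addr0 divr1 mul1r mulr0 !mul0r addr0.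
apply: (@le_trans _ _ (D s * t)); last first.
  by rewrite ler_wpM2r// (bigD1 s)//= -addrA lerDl addr_ge0// sumr_ge0.
rewrite fa (Hl s)// /D mulr_suml.
apply: (le_trans (ler_norm_sum _ _ _)); apply: ler_sum => j _.
rewrite EQ extE !normrM -mulrA ler_wpM2l//.
have d0 := ltW (circ_den_gt0 (circ_pt (s j) j)).
by rewrite normrX ger0_norm// ler_wpM2l// exprn_ge0.
Qed.

End rotation_parametrization.

(** * Random variables with moments of all orders *)

Section all_moments.
Context {R : realType} d (T : measurableType d) (P : probability T R).

(** Unlike square integrability, this property is stable under products, hence passes to
    polynomials. *)
Definition all_moments (X : T -> R) := measurable_fun setT X /\
  forall k, P.-integrable setT (EFin \o (fun w => `|X w| ^+ k)).

Lemma all_moments_cst c : all_moments (fun=> c).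
Proof.
split=> // k; apply: (@bounded_integrable _ _ _ P _ (`|c| ^+ k)) => //.
by move=> w; rewrite ger0_norm ?exprn_ge0.
Qed.

Lemma all_momentsD X Y : all_moments X -> all_moments Y ->
  all_moments (fun w => X w + Y w).
Proof.
move=> [mX iX] [mY iY]; split; first exact: measurable_funD.
move=> k.
have iXY := integrableZl measurableT (2 ^+ k) (integrableD measurableT (iX k) (iY k)).
apply: (le_integrable _ _ _ iXY) => //.
  apply/measurable_EFinP/measurable_funX; apply: measurableT_comp => //.
  exact: measurable_funD.
move=> w _ /=; rewrite lee_fin normrX normr_id.
rewrite [leRHS]ger0_norm; last first.
  by rewrite mulr_ge0 ?exprn_ge0// addr_ge0 ?exprn_ge0.
wlog XY : X Y mX iX mY iY {iXY} / `|X w| <= `|Y w|.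
  move=> H; have [h|h] := leP `|X w| `|Y w|; first exact: H.
  have /= := H Y X mY iY mX iX (ltW h).
  by rewrite [`|Y w| ^+ k + _]addrC [Y w + _]addrC.
apply: (@le_trans _ _ ((2 * `|Y w|) ^+ k)).
  rewrite lerXn2r ?nnegrE ?mulr_ge0//.
  by rewrite (le_trans (ler_normD _ _))// mulrDl mul1r lerD2r.
by rewrite exprMn ler_wpM2l ?exprn_ge0// lerDr exprn_ge0.
Qed.

Lemma all_momentsM X Y : all_moments X -> all_moments Y ->
  all_moments (fun w => X w * Y w).
Proof.
move=> [mX iX] [mY iY]; split; first exact: measurable_funM.
move=> k.
have iXY := integrableD measurableT (iX (k + k)%N) (iY (k + k)%N).
apply: (le_integrable _ _ _ iXY) => //.
  apply/measurable_EFinP/measurable_funX; apply: measurableT_comp => //.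
  exact: measurable_funM.
move=> w _ /=; rewrite lee_fin normrX normr_id normrM exprMn.
rewrite [leRHS]ger0_norm; last by rewrite addr_ge0 ?exprn_ge0.
rewrite !exprD; set x := _ ^+ k; set y := _ ^+ k.
have x0 : 0 <= x by rewrite exprn_ge0.
have y0 : 0 <= y by rewrite exprn_ge0.
by have := sqr_ge0 (x - y); nra.
Qed.

Lemma all_moments_integrable X : all_moments X -> P.-integrable setT (EFin \o X).
Proof.
move=> [mX iX]; apply: (le_integrable _ _ _ (iX 1%N)) => //; first exact/measurable_EFinP.
by move=> w _; rewrite /= lee_fin expr1 normr_id.
Qed.

Lemma polyfun_all_moments (J : Type) (X : J -> T -> R) n f :
  (forall j, all_moments (X j)) -> polyfun n f ->
  all_moments (fun w => f (fun j => X j w)).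
Proof.
move=> mX; elim=> {n f} [c|i|n f g _ pf _ pg|m n f g _ pf _ pg|m n f mn _ pf] //.
- exact: all_moments_cst.
- exact: all_momentsD.
- exact: all_momentsM.
Qed.

End all_moments.

Section product_integrals.
Context {R : realType} d1 (T1 : measurableType d1) (P1 : probability T1 R)
  d2 (T2 : measurableType d2) (P2 : probability T2 R).

Lemma ge0_integral_fst (g : T1 -> \bar R) : measurable_fun setT g ->
  (forall x, 0 <= g x)%E -> (\int[(P1 \x P2)%E]_w g w.1 = \int[P1]_x g x)%E.
Proof.
move=> mg g0; rewrite (@fubini_tonelli1 _ _ _ _ _ P1 P2 (fun w => g w.1))//; last first.
  exact: measurableT_comp.
apply: eq_integral => x _; rewrite /fubini_F/=.
by rewrite integral_cst//= probability_setT mule1.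
Qed.

Lemma ge0_integral_snd (g : T2 -> \bar R) : measurable_fun setT g ->
  (forall x, 0 <= g x)%E -> (\int[(P1 \x P2)%E]_w g w.2 = \int[P2]_x g x)%E.
Proof.
move=> mg g0; rewrite (@fubini_tonelli2 _ _ _ _ _ P1 P2 (fun w => g w.2))//; last first.
  exact: measurableT_comp.
apply: eq_integral => x _; rewrite /fubini_G/=.
by rewrite integral_cst//= probability_setT mule1.
Qed.

Lemma ge0_integral_fst_snd (g : T1 -> \bar R) (h : T2 -> \bar R) :
  measurable_fun setT g -> measurable_fun setT h ->
  (forall x, 0 <= g x)%E -> (forall x, 0 <= h x)%E ->
  (\int[(P1 \x P2)%E]_w (g w.1 * h w.2) = (\int[P1]_x g x) * (\int[P2]_x h x))%E.
Proof.
move=> mg mh g0 h0; rewrite (@fubini_tonelli1 _ _ _ _ _ P1 P2 (fun w => g w.1 * h w.2)%E)//; last 2 first.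
- by apply: emeasurable_funM; exact: measurableT_comp.
- by move=> w; rewrite mule_ge0.
under eq_integral do rewrite /fubini_F/= ge0_integralZl//.
by rewrite ge0_integralZr// integral_ge0.
Qed.

Lemma all_moments_fst (X : T1 -> R) : all_moments P1 X ->
  all_moments (P1 \x P2)%E (fun w => X w.1).
Proof.
move=> [mX iX]; split; first exact: measurableT_comp.
move=> k; apply/integrableP; split.
  apply/measurable_EFinP/measurable_funX; apply: measurableT_comp => //.
  exact: measurableT_comp.
have [m h] := integrableP _ _ _ (iX k).
by rewrite (ge0_integral_fst (g := fun x => `|(`|X x| ^+ k)%:E|%E))//; exact: measurableT_comp.
Qed.

Lemma all_moments_snd (X : T2 -> R) : all_moments P2 X ->
  all_moments (P1 \x P2)%E (fun w => X w.2).
Proof.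
move=> [mX iX]; split; first exact: measurableT_comp.
move=> k; apply/integrableP; split.
  apply/measurable_EFinP/measurable_funX; apply: measurableT_comp => //.
  exact: measurableT_comp.
have [m h] := integrableP _ _ _ (iX k).
by rewrite (ge0_integral_snd (g := fun x => `|(`|X x| ^+ k)%:E|%E))//; exact: measurableT_comp.
Qed.

End product_integrals.

(** * Second moments controlled by small tails *)

Section gaussian_polynomials.
Context {R : realType} {H : normedModType R} (ip : H -> H -> R)
  (Hip : is_inner_product ip) (I : eqType) (e : I -> H)
  (ortho : forall i j, ip (e i) (e j) = (i == j)%:R)
  d (Omega : measurableType d) (P : probability Omega R)
  (W : H -> Omega -> R) (HW : isonormal ip P W).
Local Notation PP := (P \x P)%E.
Local Notation xi := (fun w i => W (e i) w).

Lemma coord_integral (i : I) (p : {poly R}) :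
  (\int[P]_w p.[W (e i) w] = \int[lebesgue_measure]_x (p.[x] * normal_pdf 0 1 x))%R /\
  P.-integrable setT (EFin \o (fun w => p.[W (e i) w])).
Proof.
have mp : measurable_fun setT (fun x : R => p.[x]).
  exact: (continuous_measurable_fun (@continuous_horner _ p)).
have e1 : \sum_(j <- [:: (1 : R, e i)]) \sum_(k <- [:: (1 : R, e i)]) j.1 * k.1 * ip j.2 k.2 = 1.
  by rewrite !big_seq1/= ortho eqxx !mulr1.
have law A : measurable A -> P (W (e i) @^-1` A) = normal_prob 0 1 A.
  have -> : W (e i) = fun w => \sum_(k <- [:: (1 : R, e i)]) k.1 * W k.2 w.
    by apply/funext => w; rewrite big_seq1 mul1r.
  exact: (isonormal_standard HW e1).
by have [] := standard_normal_integral (HW.1 (e i)) law mp (exp_bounded_horner p).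
Qed.

Lemma coord_all_moments (i : I) : all_moments P (W (e i)).
Proof.
split; first exact: HW.1.
move=> k; have [_ ik] := coord_integral i 'X^k.
apply: (le_integrable _ _ _ ik) => //.
  by apply/measurable_EFinP/measurable_funX; apply: measurableT_comp => //; exact: HW.1.
by move=> w _; rewrite /= hornerXn lee_fin normrX normr_id normrX.
Qed.

Lemma polyfun_moments n f : polyfun n f -> all_moments P (fun w => f (xi w)).
Proof. by apply: polyfun_all_moments => i; exact: coord_all_moments. Qed.

Lemma measurable_xi : measurable_fun setT (fun w => xi w : path_space I).
Proof. by apply: measurable_path => i; exact: HW.1. Qed.

(** Two combinations of the copies form a single family, indexed by a boolean and a coordinate, so
    that their joint law can be compared. *)
Definition rotated (a b c f : R) (bi : bool * I) (w : Omega * Omega) : R :=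
  if bi.1 then a * W (e bi.2) w.1 + b * W (e bi.2) w.2
  else c * W (e bi.2) w.1 + f * W (e bi.2) w.2.

Lemma measurable_rotated a b c f bi : measurable_fun setT (rotated a b c f bi).
Proof.
by rewrite /rotated; case: bi.1; apply: measurable_funD; apply: measurable_funM => //;
  apply: measurableT_comp => //; exact: HW.1.
Qed.

Lemma rotated_same_law a b c f a' b' c' f' :
  a ^+ 2 + b ^+ 2 = a' ^+ 2 + b' ^+ 2 -> c ^+ 2 + f ^+ 2 = c' ^+ 2 + f' ^+ 2 ->
  a * c + b * f = a' * c' + b' * f' ->
  same_law PP (rotated a b c f) PP (rotated a' b' c' f').
Proof.
move=> h1 h2 h3.
have E a0 b0 c0 f0 : rotated a0 b0 c0 f0 =
    gaussian_pair e W (fun bi : bool * I => if bi.1 then a0 else c0) snd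
      (fun bi => if bi.1 then b0 else f0) snd.
  by apply/funext => -[[] i]; apply/funext => w.
rewrite !E; apply: (gaussian_pair_same_law Hip ortho HW) => -[bj j] [bl l].
rewrite /gaussian_gram/= -!mulrDl; congr (_ * _).
by case: bj bl => -[]; lra.
Qed.

Lemma rotated_integral (F : (I -> R) -> (I -> R) -> \bar R) (a b c f a' b' c' f' : R) :
  measurable_fun setT (fun x : path_space (bool * I) =>
    F (fun i => x (true, i)) (fun i => x (false, i))) ->
  a ^+ 2 + b ^+ 2 = a' ^+ 2 + b' ^+ 2 -> c ^+ 2 + f ^+ 2 = c' ^+ 2 + f' ^+ 2 ->
  a * c + b * f = a' * c' + b' * f' ->
  (\int[PP]_w F (fun i => a * xi w.1 i + b * xi w.2 i)%R (fun i => c * xi w.1 i + f * xi w.2 i)%R =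
   \int[PP]_w F (fun i => a' * xi w.1 i + b' * xi w.2 i)%R (fun i => c' * xi w.1 i + f' * xi w.2 i)%R)%E.
Proof.
move=> mF h1 h2 h3.
exact: (same_law_integral (measurable_rotated a b c f) (measurable_rotated a' b' c' f') mF
  (rotated_same_law h1 h2 h3)).
Qed.

Lemma measurable_half b : measurable_fun setT
  (fun x : @path_space R (bool * I) => (fun i => x (b, i)) : path_space I).
Proof. by apply: measurable_path => i; exact: measurable_coord. Qed.

(* [c] and [K] depend on the degree only, not on the number of variables of [f]:
   this plays the role of hypercontractivity. *)
Lemma second_moment_bound q : exists c K : R, [/\ 0 < c, 0 < K &
  forall (f : (I -> R) -> R) (delta : R), polyfun q f -> 0 < delta ->
    (P [set w | (delta < `|f (xi w)|)%R] <= c%:E)%E ->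
    (\int[P]_w ((f (xi w)) ^+ 2)%:E <= (K * delta ^+ 2)%:E)%E].
Proof.
have [C [C1 HC]] := @polyfun_interpolation_bound R q.
pose n := q.*2.+1.
(* Each of the n nodes contributes at most C^2 c E f^2, in total E f^2 / 2 for this c. Then E f^2 <=
   C^2 delta^2 + E f^2 / 2 gives K = 2 C^2. *)
exists (2 * n%:R * C ^+ 2)^-1, (2 * C ^+ 2); split.
- by rewrite invr_gt0 !mulr_gt0// ?ltr0n// exprn_gt0.
- by rewrite mulr_gt0// exprn_gt0.
move=> f delta pf d0 Pd.
have mf := measurable_polyfun pf.
have mfx : measurable_fun setT (fun w => f (xi w)) := (polyfun_moments pf).1.
pose A := [set x : path_space I | delta < `|f x|].
have mA : measurable A.
  have mnf : measurable_fun setT (fun x : path_space I => `|f x|) by exact: measurableT_comp.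
  have := mnf measurableT `]delta, +oo[%classic (measurable_itv _).
  rewrite setTI; congr (measurable _).
  by apply/seteqP; split=> x /=; rewrite in_itv/= andbT.
have mIA : measurable_fun setT (\1_A : path_space I -> R) by exact: measurable_indic.
pose M2 := (\int[P]_w ((f (xi w)) ^+ 2)%:E)%E.
have M20 : (0 <= M2)%E by apply: integral_ge0 => w _; rewrite lee_fin sqr_ge0.
have iM2 := (polyfun_moments pf).2 2%N.
(* Finiteness is what permits absorbing half of [M2] into the left side. *)
have M2fin : M2 \is a fin_num.
  have := integrable_fin_num measurableT iM2.
  by under eq_integral do rewrite /= real_normK ?num_real//.
(* The cost of using x as a node when f is too large at the orthogonal point y. *)
pose F (x y : I -> R) : \bar R := ((f x) ^+ 2 * \1_A y)%:E.
have F0 x y : (0 <= F x y)%E by rewrite lee_fin mulr_ge0 ?sqr_ge0.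
have mF : measurable_fun setT (fun x : path_space (bool * I) =>
    F (fun i => x (true, i)) (fun i => x (false, i))).
  apply/measurable_EFinP; apply: measurable_funM.
    apply: measurable_funX.
    exact: (measurableT_comp mf (measurable_half true)).
  exact: (measurableT_comp mIA (measurable_half false)).
pose T s j (w : Omega * Omega) (i : I) :=
  circ_x (circ_pt s j) * xi w.1 i + circ_y (circ_pt s j) * xi w.2 i.
have key w : (((f (xi w.1)) ^+ 2)%:E <=
    (C ^+ 2 * delta ^+ 2)%:E + \sum_(j < n) (C ^+ 2)%:E * F (T false j w) (T true j w))%E.
  rewrite /F; under eq_bigr do rewrite -EFinM.
  rewrite sumEFin -EFinD lee_fin -mulr_sumr -mulrDr.
  set S := \sum_(j < n) _.
  have S0 : 0 <= S by apply: sumr_ge0 => j _; rewrite mulr_ge0 ?sqr_ge0.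
  have dS0 : 0 <= delta ^+ 2 + S by rewrite addr_ge0 ?sqr_ge0.
  (* One bound serves at all nodes: either |f| <= delta at the [true] point, or the square of f at
     the [false] point is a term of S. *)
  have := HC I f (xi w.1) (xi w.2) (Num.sqrt (delta ^+ 2 + S)) pf (sqrtr_ge0 _).
  move=> /(_ _)/wrap[j jn|h].
    have [dj|dj] := ltP delta `|f (T true j w)|.
      exists false; rewrite -/(T false j w) -sqrtr_sqr ler_wsqrtr//.
      rewrite /S (bigD1 (Ordinal jn))//= [X in _ * X]indicE mem_set// mulr1.
      rewrite addrCA lerDl addr_ge0 ?sqr_ge0// sumr_ge0// => k _.
      by rewrite mulr_ge0 ?sqr_ge0.
    exists true; rewrite -/(T true j w) (le_trans dj)//.
    rewrite -[leLHS](ger0_norm (ltW d0)) -sqrtr_sqr ler_wsqrtr// lerDl//.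
  have n1 : `|f (xi w.1)| \is Num.nneg by rewrite nnegrE.
  have n2 : C * Num.sqrt (delta ^+ 2 + S) \is Num.nneg.
    by rewrite nnegrE mulr_ge0 ?sqrtr_ge0// ltW.
  by move: (lerXn2r 2 n1 n2 h); rewrite real_normK ?num_real// exprMn sqr_sqrtr.
(* The two points are orthogonal, so jointly they have the law of the independent copies and the
   integral factorizes. *)
have termE j : (\int[PP]_w F (T false j w) (T true j w) = M2 * P [set w | (delta < `|f (xi w)|)%R])%E.
  have u1 := circ_unit (circ_pt false j : R).
  transitivity (\int[PP]_w F (fun i => 1 * xi w.1 i + 0 * xi w.2 i)%R (fun i => 0 * xi w.1 i + 1 * xi w.2 i)%R)%E.
    apply: rotated_integral => //; rewrite ?circ_pt_x ?circ_pt_y; [|rewrite sqrrN addrC|]; rewrite ?u1; lra.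
  transitivity (\int[PP]_w (((f (xi w.1)) ^+ 2)%:E * (\1_A (xi w.2))%:E))%E.
    apply: eq_integral => w _; rewrite /F -EFinM; congr (_%:E); congr (f _ ^+ 2 * \1_A _);
    by apply/funext => i; rewrite ?mul0r ?mul1r ?addr0 ?add0r.
  rewrite (@ge0_integral_fst_snd _ _ _ P _ _ P (fun w => ((f (xi w)) ^+ 2)%:E) (fun w => (\1_A (xi w))%:E)) => //.
  - congr (_ * _)%E; have mA' := measurable_xi measurableT mA; rewrite setTI in mA'.
    by have := integral_indic P measurableT mA'; rewrite setIT.
  - exact/measurable_EFinP/measurable_funX.
  - apply/measurable_EFinP; exact: (measurableT_comp mIA measurable_xi).
  - by move=> x; rewrite lee_fin sqr_ge0.
have mT s j : measurable_fun setT (fun w => T s j w : path_space I).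
  apply: measurable_path => i; apply: measurable_funD; apply: measurable_funM => //;
  by apply: measurableT_comp => //; exact: HW.1.
have mFT j : measurable_fun setT (fun w => F (T false j w) (T true j w)).
  apply/measurable_EFinP; apply: measurable_funM.
    apply: measurable_funX; exact: (measurableT_comp mf (mT false j)).
  exact: (measurableT_comp mIA (mT true j)).
have C20 : (0 <= (C ^+ 2)%:E :> \bar R)%E by rewrite lee_fin sqr_ge0.
have step : (M2 <= (C ^+ 2 * delta ^+ 2)%:E + (2^-1)%:E * M2)%E.
  rewrite {1}/M2 -(@ge0_integral_fst _ _ _ P _ _ P (fun w => ((f (xi w)) ^+ 2)%:E)); last 2 first.
  - exact/measurable_EFinP/measurable_funX.
  - by move=> w; rewrite lee_fin sqr_ge0.
  apply: (@le_trans _ _ (\int[PP]_w ((C ^+ 2 * delta ^+ 2)%:E +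
      \sum_(j < n) (C ^+ 2)%:E * F (T false j w) (T true j w)))%E).
    apply: ge0_le_integral => //.
    - by move=> w _; rewrite lee_fin sqr_ge0.
    - apply/measurable_EFinP.
      exact: (measurableT_comp (measurable_funX 2 mfx) measurable_fst).
    - apply: emeasurable_funD => //; apply: emeasurable_sum => j.
      exact: emeasurable_funM.
  rewrite ge0_integralD//; last 3 first.
  - by move=> w _; rewrite lee_fin mulr_ge0 ?sqr_ge0.
  - by move=> w _; apply: sume_ge0 => j _; rewrite mule_ge0.
  - by apply: emeasurable_sum => j; exact: emeasurable_funM.
  rewrite integral_cst//= probability_setT mule1 leeD2l//.
  rewrite ge0_integral_sum//; last 2 first.
  - by move=> j; exact: emeasurable_funM.
  - by move=> j w _; rewrite mule_ge0.
  under eq_bigr do rewrite ge0_integralZl// termE.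
  set p := P _; have pfin : p \is a fin_num.
    have mA' := measurable_xi measurableT mA; rewrite setTI in mA'.
    exact: (fin_num_measure P _ mA').
  rewrite -(fineK M2fin) -(fineK pfin) -!EFinM sumEFin lee_fin sumr_const card_ord.
  have p0 : 0 <= fine p by apply: fine_ge0; exact: measure_ge0.
  have m0 : 0 <= fine M2 by rewrite fine_ge0.
  have pc : fine p <= (2 * n%:R * C ^+ 2)^-1 by rewrite -lee_fin fineK.
  rewrite -[_ *+ n]mulr_natr.
  rewrite (_ : _ * n%:R = fine M2 * (n%:R * C ^+ 2 * fine p)); last by ring.
  rewrite mulrC ler_wpM2r//.
  have nC : 0 < n%:R * C ^+ 2 by rewrite mulr_gt0 ?ltr0n ?exprn_gt0.
  apply: (@le_trans _ _ (n%:R * C ^+ 2 * (2 * n%:R * C ^+ 2)^-1)).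
    by rewrite ler_wpM2l// ltW.
  rewrite le_eqVlt; apply/orP; left; apply/eqP; field.
  by rewrite !gt_eqF// ?ltr0n.
rewrite -/M2; move: step; rewrite -(fineK M2fin) -EFinM -EFinD !lee_fin.
set m := fine M2; set x := C ^+ 2 * _ => h.
by rewrite -mulrA -/x; lra.
Qed.

End gaussian_polynomials.

(** * Hermite polynomials and Wiener chaoses *)

Section hermite_polynomials.
Context {R : realType}.
Local Notation phi := (normal_pdf (0 : R) 1).
Local Notation gE f := (\int[@lebesgue_measure R]_x (f x * phi x))%R.

Fixpoint hermite_poly (n : nat) : {poly R} :=
  if n is m.+1 then 'X * hermite_poly m - (hermite_poly m)^`() else 1.

Lemma deriv_hermite_poly n : (hermite_poly n.+1)^`() = n.+1%:R *: hermite_poly n.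
Proof.
elim: n => [|n IH].
  by rewrite /= mulr1 (_ : 1^`() = 0)// ?subr0 ?derivX ?scale1r// -[1]/(1%:P) derivC.
have E : hermite_poly n.+2 = 'X * hermite_poly n.+1 - n.+1%:R *: hermite_poly n.
  by rewrite -IH.
rewrite E derivB derivM derivX mul1r derivZ IH -scalerAr -addrA -scalerBr.
rewrite -[_ - _]/(hermite_poly n.+1) -{1}[hermite_poly n.+1]scale1r -scalerDl.
by rewrite -[in RHS]natr1 addrC.
Qed.

Lemma size_hermite_poly n : (size (hermite_poly n) <= n.+1)%N.
Proof.
elim: n => [|n IH] /=; first by rewrite size_poly1.
apply: (leq_trans (size_polyD _ _)); rewrite geq_max size_polyN; apply/andP; split.
  by apply: (leq_trans (size_polyMleq _ _)); rewrite size_polyX.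
by apply: (leq_trans (size_poly _ _)); apply: (leq_trans (leq_pred _)); exact: leqW.
Qed.

(** Each derivative of the Gaussian is a polynomial times it, and the product rule is the recurrence
    of [hermite_poly] up to sign. *)
Lemma hermiteE n (x : R) : hermite n x = (hermite_poly n).[x].
Proof.
pose g (y : R) := expR (- (y ^+ 2) / 2).
have dg (p : {poly R}) (y : R) : is_derive y (1 : R) (fun y => p.[y] * g y) ((p^`() - 'X * p).[y] * g y).
  have dp : is_derive y (1 : R) (horner p) p^`().[y].
    by rewrite derivE derive1E; apply: derivableP; exact: derivable_horner.
  have dg : is_derive y (1 : R) g (- y * g y).
    by rewrite /g; apply: is_derive_eq; rewrite /GRing.scale/=; field.
  apply: is_derive_eq; rewrite /GRing.scale/= hornerD hornerN hornerM hornerX; ring.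
have dn y : derive1n n g y = (-1) ^+ n * ((hermite_poly n).[y] * g y).
  elim: n y => [|n IH] y; first by rewrite /= hornerC !mul1r.
  rewrite derive1nS (_ : derive1n n g = fun y => (-1) ^+ n * ((hermite_poly n).[y] * g y)); last exact/funext.
  rewrite derive1E.
  have h : is_derive y (1 : R) ((-1) ^+ n \*: (fun y0 : R => (hermite_poly n).[y0] * g y0))
    ((-1) ^+ n *: (((hermite_poly n)^`() - 'X * hermite_poly n).[y] * g y)).
    by apply: is_deriveZ.
  rewrite (_ : (fun _ => _) = (-1) ^+ n \*: (fun y0 : R => (hermite_poly n).[y0] * g y0)); last exact/funext.
  rewrite derive_val /GRing.scale/= exprS !(hornerD, hornerN, hornerM, hornerX).
  ring.
rewrite /hermite dn /g mulrACA -exprD -signr_odd oddD addbb expr0 mul1r.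
rewrite mulrCA -expRD (_ : x ^+ 2 / 2 + _ = 0) ?expR0 ?mulr1//.
by field.
Qed.

Lemma gE_integrable (p : {poly R}) :
  (@lebesgue_measure R).-integrable setT (EFin \o (fun x => p.[x] * phi x)).
Proof.
apply: (exp_bounded_integrable (f := horner p)); last exact: exp_bounded_horner.
exact: (continuous_measurable_fun (@continuous_horner _ p)).
Qed.

Lemma gE_hornerD (p q : {poly R}) : gE (fun x => (p + q).[x]) = gE (fun x => p.[x]) + gE (fun x => q.[x]).
Proof.
rewrite -RintegralD//; [|exact: gE_integrable|exact: gE_integrable].
by apply: eq_Rintegral => x _; rewrite hornerD mulrDl.
Qed.

Lemma gE_hornerZ c (p : {poly R}) : gE (fun x => (c *: p).[x]) = c * gE (fun x => p.[x]).
Proof.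
rewrite -RintegralZl//; [|exact: gE_integrable].
by apply: eq_Rintegral => x _; rewrite hornerZ mulrA.
Qed.

(** In the recurrence, Stein's identity replaces y z H_m by y^2 H_m'. Since y^2 - 1 = - x^2, what
    remains is the recurrence satisfied by x^n H_n(a). *)
Lemma mehler_hermite n (x y a : R) : x ^+ 2 + y ^+ 2 = 1 ->
  gE (fun z => (hermite_poly n).[x * a + y * z]) = x ^+ n * (hermite_poly n).[a].
Proof.
move=> xy.
pose L : {poly R} := (x * a)%:P + y *: 'X.
pose Q m := hermite_poly m \Po L.
have QE m z : (Q m).[z] = (hermite_poly m).[x * a + y * z].
  by rewrite horner_comp /L !hornerE.
(* As H_m' is a multiple of H_(m-1), the recurrence has order two, and two consecutive degrees are
   carried along. *)
suff H : forall m, gE (fun z => (Q m).[z]) = x ^+ m * (hermite_poly m).[a] /\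
    gE (fun z => (Q m.+1).[z]) = x ^+ m.+1 * (hermite_poly m.+1).[a].
  by rewrite -(H n).1; apply: eq_Rintegral => z _; rewrite QE.
have dL : L^`() = y%:P by rewrite /L derivD derivC add0r derivZ derivX alg_polyC.
have gX m : gE (fun z => ('X * Q m).[z]) = y * gE (fun z => ((hermite_poly m)^`() \Po L).[z]).
  transitivity (gE (fun z => z * (Q m).[z])).
    by apply: eq_Rintegral => z _; rewrite hornerM hornerX.
  rewrite stein_poly deriv_comp dL -gE_hornerZ.
  by apply: eq_Rintegral => z _; rewrite [_ * y%:P]mulrC mul_polyC.
have step m : gE (fun z => (Q m.+1).[z]) = x * a * gE (fun z => (Q m).[z])
    - x ^+ 2 * gE (fun z => ((hermite_poly m)^`() \Po L).[z]).
  transitivity (gE (fun z => ((x * a) *: Q m + (y *: ('X * Q m) + (- 1) *: ((hermite_poly m)^`() \Po L))).[z])).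
    apply: eq_Rintegral => z _; congr (_ * _).
    rewrite /Q /= comp_polyB comp_polyM comp_polyX.
    rewrite !(hornerD, hornerN, hornerM, hornerZ, hornerX, hornerC); ring.
  rewrite !gE_hornerD !gE_hornerZ gX.
  have -> : x ^+ 2 = 1 - y ^+ 2 by lra.
  ring.
have g0 : gE (fun z => (Q 0%N).[z]) = 1.
  rewrite /Q /= comp_polyC; transitivity (\int[@lebesgue_measure R]_z phi z)%R.
    by apply: eq_Rintegral => z _; rewrite hornerC mul1r.
  by rewrite /Rintegral integral_normal_pdf.
elim=> [|m [IH1 IH2]].
  split; first by rewrite g0 /= hornerC expr0 mulr1.
  have d0 : (hermite_poly 0)^`() = 0 :> {poly R} by rewrite /= -polyC1 derivC.
  rewrite step g0 d0 comp_poly0 (_ : gE (fun z => 0.[z]) = 0); last first.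
    by under eq_Rintegral do rewrite horner0 mul0r; rewrite /Rintegral integral0.
  have -> : hermite_poly 1 = 'X - (hermite_poly 0)^`() :> {poly R} by rewrite /= mulr1.
  by rewrite d0 subr0 hornerX; ring.
split=> //.
rewrite step IH2 deriv_hermite_poly comp_polyZ gE_hornerZ -/(Q m) IH1.
rewrite -[hermite_poly m.+2]/('X * hermite_poly m.+1 - (hermite_poly m.+1)^`()).
have hA (A B : {poly R}) : ('X * A - m.+1%:R *: B).[a] = a * A.[a] - m.+1%:R * B.[a].
  by rewrite !hornerE.
by rewrite deriv_hermite_poly hA !exprS; ring.
Qed.

End hermite_polynomials.

(** * Chaoses as spaces of polynomials *)

Section chaos_polynomials.
Context {R : realType} {H : normedModType R} (ip : H -> H -> R)
  (Hip : is_inner_product ip) (I : eqType) (e : I -> H)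
  (ortho : forall i j, ip (e i) (e j) = (i == j)%:R)
  d (Omega : measurableType d) (P : probability Omega R)
  (W : H -> Omega -> R) (HW : isonormal ip P W).
Local Notation PP := (P \x P)%E.
Local Notation xi := (fun w i => W (e i) w).

(** Independence of distinct coordinates: taking coordinate [j] from the second copy and the others
    from the first preserves the law, and then the factor of [j] splits off by Fubini. *)
Lemma integral_prod_coord (s : seq I) (p : I -> {poly R}) : uniq s ->
  (\int[P]_w \prod_(i <- s) (p i).[W (e i) w] =
   \prod_(i <- s) \int[lebesgue_measure]_x ((p i).[x] * normal_pdf 0 1 x))%R.
Proof.
elim: s => [_|j s IH /= /andP[js us]].
  under eq_Rintegral do rewrite big_nil.
  by rewrite big_nil Rintegral_cst//= probability_setT mulr1.
rewrite big_cons -IH// -(coord_integral ortho HW j (p j)).1.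
pose X (i : I) := gaussian_pair e W (fun i => (i != j)%:R) id (fun i => (i == j)%:R) id i.
have law : same_law PP X P (fun i => W (e i)).
  apply: (gaussian_pair_same_law1 Hip ortho HW) => k l; rewrite /gaussian_gram.
  have [<-|kl] := eqVneq k l; last by rewrite !mulr0 addr0.
  by case: (k == j) => /=; ring.
have pfs (t : seq I) : polyfun (\sum_(i <- t) (size (p i)).-1) (fun x : I -> R => \prod_(i <- t) (p i).[x i]).
  by apply: polyfun_prod => i; exact: polyfun_horner.
have mpfs t := measurable_polyfun (pfs t).
have mX i : measurable_fun setT (X i) by exact: (measurable_gaussian_pair _ HW).
have mW i : measurable_fun setT (W (e i)) by exact: HW.1.
pose f (w : Omega * Omega) := (\prod_(i <- s) (p i).[W (e i) w.1]) * (p j).[W (e j) w.2].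
have am1 : all_moments P (fun w => \prod_(i <- s) (p i).[W (e i) w]).
  exact: (polyfun_moments ortho HW (pfs s)).
have am2 : all_moments P (fun w => (p j).[W (e j) w]).
  exact: (polyfun_moments ortho HW (polyfun_horner (p j) j)).
have amf : all_moments PP f.
  exact: (all_momentsM (all_moments_fst P am1) (all_moments_snd P am2)).
have [_ E] : (\int[P]_x \int[P]_y f (x, y) = \int[P]_y \int[P]_x f (x, y))%R /\
    (\int[P]_x \int[P]_y f (x, y) = \int[PP]_z f z)%R.
  apply: Rintegral_Fubini; first exact: all_moments_integrable amf.
  - move=> x; have := integrableZl measurableT (\prod_(i <- s) (p i).[W (e i) x]) (all_moments_integrable am2).
    by apply: eq_integrable => // y _; rewrite /= EFinM.
  - move=> y; have := integrableZl measurableT ((p j).[W (e j) y]) (all_moments_integrable am1).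
    by apply: eq_integrable => // x _; rewrite /f /= mulrC EFinM.
transitivity (\int[PP]_w f w)%R.
  rewrite /Rintegral; congr fine.
  transitivity (\int[PP]_w (\prod_(i <- j :: s) (p i).[X i w])%:E)%E.
    apply/esym; apply: (same_law_integral mX mW (f := fun x => (\prod_(i <- j :: s) (p i).[x i])%:E)) law.
    by apply/measurable_EFinP; exact: mpfs.
  apply: eq_integral => w _; rewrite /f big_cons mulrC; congr (_ * _)%:E.
    rewrite big_seq [RHS]big_seq; apply: eq_bigr => i is_.
    have ij : i != j by apply: contraNneq js => <-.
    by rewrite /X /gaussian_pair ij (negbTE ij) mul1r mul0r addr0.
  by rewrite /X /gaussian_pair eqxx mul0r add0r mul1r.
rewrite -E mulrC -RintegralZr//; last exact: all_moments_integrable am1.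
apply: eq_Rintegral => w _; rewrite -RintegralZl//; exact: all_moments_integrable am2.
Qed.

(* By Mehler's formula, the second condition characterizes the [n]-th chaos among
   polynomials in the coordinates. *)
Definition chaos_polyfun (n : nat) (f : (I -> R) -> R) := polyfun n f /\
  forall (x y : R) (a : I -> R), x ^+ 2 + y ^+ 2 = 1 ->
    (\int[P]_w f (fun i => x * a i + y * W (e i) w) = x ^+ n * f a)%R.

(** Mehler's formula multiplies over independent coordinates, and the powers of x add up. *)
Lemma chaos_polyfun_prod (s : seq I) (b : I -> nat) : uniq s ->
  chaos_polyfun (\sum_(i <- s) b i) (fun z => \prod_(i <- s) (hermite_poly (b i)).[z i]).
Proof.
move=> us; split.
  apply: polyfun_prod => i; apply: (polyfun_leq _ (polyfun_horner _ _)).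
  by have := @size_hermite_poly R (b i); case: (size _).
move=> x y a xy.
transitivity (\int[P]_w \prod_(i <- s) (hermite_poly (b i) \Po ((x * a i)%:P + y *: 'X)).[W (e i) w])%R.
  apply: eq_Rintegral => w _; apply: eq_bigr => i _.
  by rewrite horner_comp !hornerE.
rewrite integral_prod_coord//.
rewrite (big_morph _ (exprD x) (expr0 x)) -big_split/=; apply: eq_bigr => i _.
rewrite -(mehler_hermite (b i) (a i) xy); apply: eq_Rintegral => z _.
by rewrite horner_comp !hornerE.
Qed.

Lemma chaos_spanP n Y : chaos_span e W n Y ->
  exists2 f, chaos_polyfun n f & Y = fun w => f (xi w).
Proof.
move=> [m [c [s [b [Hs ->]]]]].
pose g (k : nat) (z : I -> R) := \prod_(i <- s k) (hermite_poly (b k i)).[z i].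
pose K k := (\prod_(i <- s k) Num.sqrt ((b k i)`!%:R : R))^-1.
exists (fun z => \sum_(k < m) (c k * K k) * g k z).
  have pg (k : 'I_m) : chaos_polyfun n (g k).
    by have [us <-] := Hs k (ltn_ord k); exact: chaos_polyfun_prod.
  split.
    by apply: polyfun_sum => k; apply: polyfun_scale; exact: (pg k).1.
  move=> x y a xy.
  have am (k : 'I_m) : P.-integrable setT (EFin \o (fun w => g k (fun i => x * a i + y * W (e i) w))).
    apply: all_moments_integrable.
    exact: (polyfun_moments ortho HW (polyfun_affine x y a (pg k).1)).
  have HH (r : seq 'I_m) :
     P.-integrable setT (EFin \o (fun w => \sum_(k <- r) c k * K k * g k (fun i => x * a i + y * W (e i) w))) /\
    (\int[P]_w (\sum_(k <- r) c k * K k * g k (fun i => x * a i + y * W (e i) w)) =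
      \sum_(k <- r) c k * K k * (x ^+ n * g k a))%R.
    elim: r => [|k r [IH1 IH2]].
      split.
        rewrite (_ : _ \o _ = cst 0%E); first exact: integrable0.
        by apply/funext => w /=; rewrite big_nil.
      under eq_Rintegral do rewrite big_nil.
      by rewrite big_nil Rintegral_cst//= mul0r.
    have ik : P.-integrable setT (EFin \o (fun w => c k * K k * g k (fun i => x * a i + y * W (e i) w))).
      have := integrableZl measurableT (c k * K k) (am k).
      by apply: eq_integrable => // w _; rewrite /= EFinM.
    split.
      have := integrableD measurableT ik IH1.
      by apply: eq_integrable => // w _; rewrite /= big_cons EFinD.
    under eq_Rintegral do rewrite big_cons.
    rewrite RintegralD// IH2 big_cons -((pg k).2 x y a xy); congr (_ + _).
    by apply: RintegralZl => //; exact: am.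
  rewrite (HH _).2 mulr_sumr; apply: eq_bigr => k _; ring.
apply/funext => w; apply: eq_bigr => k _.
rewrite -mulrA; congr (_ * _); rewrite /K /g mulrC -prodf_div.
by apply: eq_bigr => i _; rewrite hermiteE.
Qed.

End chaos_polynomials.

(** * Square-integrable random variables *)

Section square_integrable.
Context {R : realType} d (T : measurableType d) (P : probability T R).

Lemma L2_mul X Y : L2 P X -> L2 P Y -> P.-integrable setT (EFin \o (fun w => X w * Y w)).
Proof.
move=> [mX iX] [mY iY]; apply: (le_integrable _ _ _ (integrableD measurableT iX iY)) => //.
  by apply/measurable_EFinP; exact: measurable_funM.
move=> w _ /=; rewrite lee_fin normrM [leRHS]ger0_norm ?addr_ge0 ?sqr_ge0//.
rewrite -(real_normK (num_real (X w))) -(real_normK (num_real (Y w))).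
by have := sqr_ge0 (`|X w| - `|Y w|); have := sqr_ge0 `|X w|; have := sqr_ge0 `|Y w|; nra.
Qed.

Lemma L2_add X Y : L2 P X -> L2 P Y -> L2 P (fun w => X w + Y w).
Proof.
move=> LX LY; have [mX iX] := LX; have [mY iY] := LY.
split; first exact: measurable_funD.
have i2 := integrableZl measurableT 2 (L2_mul LX LY).
have := integrableD measurableT (integrableD measurableT iX iY) i2.
apply: eq_integrable => // w _.
by rewrite /= -EFinM -!EFinD; congr EFin; ring.
Qed.

Lemma L2_scale c X : L2 P X -> L2 P (fun w => c * X w).
Proof.
move=> [mX iX]; split; first exact: measurable_funM.
have := integrableZl measurableT (c ^+ 2) iX; apply: eq_integrable => // w _.
by rewrite /= -EFinM exprMn.
Qed.

Lemma L2_sub X Y : L2 P X -> L2 P Y -> L2 P (fun w => X w - Y w).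
Proof.
move=> LX LY; have := L2_add LX (L2_scale (- 1) LY).
by under eq_fun do rewrite mulN1r.
Qed.

Lemma L2_0 : L2 P (fun=> 0).
Proof.
split=> //; rewrite (_ : (fun _ => _) = cst 0%E); first exact: integrable0.
by apply/funext => w; rewrite expr0n.
Qed.

Lemma L2_sum (K : Type) (s : seq K) (X : K -> T -> R) :
  (forall k, L2 P (X k)) -> L2 P (fun w => \sum_(k <- s) X k w).
Proof.
move=> LX; elim: s => [|k s IH].
  by under eq_fun do rewrite big_nil; exact: L2_0.
by under eq_fun do rewrite big_cons; exact: L2_add.
Qed.

Lemma all_moments_L2 X : all_moments P X -> L2 P X.
Proof.
move=> [mX iX]; split=> //.
by have := iX 2%N; apply: eq_integrable => // w _; rewrite /= real_normK ?num_real.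
Qed.

Lemma integral_sqr_fin X : L2 P X ->
  (\int[P]_w (X w ^+ 2)%:E)%E = (\int[P]_w (X w ^+ 2))%R%:E.
Proof. by move=> [_ iX]; rewrite (EFin_Rintegral iX). Qed.

Lemma integral_mul_approx (X Z : T -> R) : L2 P X -> L2 P Z ->
  (forall eps : R, 0 < eps -> exists Y, [/\ L2 P Y,
     (\int[P]_w (Y w * Z w))%R = 0 &
     (\int[P]_w ((X w - Y w) ^+ 2)%:E < eps%:E)%E]) ->
  (\int[P]_w (X w * Z w))%R = 0.
Proof.
move=> LX LZ app; apply/eqP; apply: contraT => nz.
set a := `|(\int[P]_w (X w * Z w))%R|; have a0 : 0 < a by rewrite normr_gt0.
pose M := (\int[P]_w (Z w ^+ 2))%R.
have M0 : 0 <= M by apply: Rintegral_ge0 => w _; exact: sqr_ge0.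
(* Weight in Young's inequality |x z| <= c x^2 / 2 + z^2 / (2 c). An error below a/c makes the first
   term less than a/2, and the second is at most a/2; the + 1 keeps [c] positive when M = 0. *)
pose c := (M + 1) / a.
have c0 : 0 < c by rewrite divr_gt0// ltr_wpDl.
have [Y [LY YZ XY]] := app (a / c) (divr_gt0 a0 c0).
have LD := L2_sub LX LY.
have XYr : (\int[P]_w ((X w - Y w) ^+ 2))%R < a / c by rewrite -lte_fin -integral_sqr_fin.
have e1 : (\int[P]_w (X w * Z w) = \int[P]_w ((X w - Y w) * Z w))%R.
  rewrite -[RHS]addr0 -YZ -RintegralD//; [|exact: L2_mul|exact: L2_mul].
  by apply: eq_Rintegral => w _; ring.
have [_ iD] := LD; have [_ iZ] := LZ.
have iDc := integrableZl measurableT (c / 2) iD.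
have iZc := integrableZl measurableT (c^-1 / 2) iZ.
suff : a <= c / 2 * (\int[P]_w ((X w - Y w) ^+ 2))%R + c^-1 / 2 * M.
  have h1 : c / 2 * (\int[P]_w ((X w - Y w) ^+ 2))%R < a / 2.
    have XYr' : c / 2 * (\int[P]_w ((X w - Y w) ^+ 2))%R < c / 2 * (a / c).
      by rewrite ltr_pM2l// divr_gt0.
    apply: (lt_le_trans XYr'); rewrite le_eqVlt; apply/orP; left; apply/eqP.
    by field; rewrite gt_eqF.
  have h2 : c^-1 / 2 * M <= a / 2.
    have M1 : 0 < M + 1 by rewrite ltr_wpDl.
    have -> : c^-1 / 2 * M = a / 2 * (M / (M + 1)).
      by rewrite /c; field; rewrite !gt_eqF.
    by rewrite ler_piMr ?divr_ge0 ?(ltW a0)// ler_pdivrMr// mul1r lerDl.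
  by lra.
rewrite /a e1; apply: (le_trans (le_normr_Rintegral measurableT (L2_mul LD LZ))).
rewrite -RintegralZl// -RintegralZl// -RintegralD//.
apply: le_Rintegral => //.
- by apply: integrable_norm; exact: L2_mul.
- exact: (integrableD measurableT iDc iZc).
move=> w _; rewrite normrM; set x := X w - Y w; set z := Z w.
rewrite -(real_normK (num_real x)) -(real_normK (num_real z)).
set x' := `|x|; set z' := `|z|.
have := sqr_ge0 (c * x' - z') => h.
have : 0 <= (c * x' - z') ^+ 2 / (2 * c) by rewrite divr_ge0// mulr_ge0// ltW.
suff -> : (c * x' - z') ^+ 2 / (2 * c) = (c / 2 * x' ^+ 2 + c^-1 / 2 * z' ^+ 2) - x' * z' by lra.
by field; rewrite gt_eqF.
Qed.

End square_integrable.

(** * Orthogonality of the chaoses *)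

Section chaos_orthogonality.
Context {R : realType} {H : normedModType R} (ip : H -> H -> R)
  (Hip : is_inner_product ip) (I : eqType) (e : I -> H)
  (ortho : forall i j, ip (e i) (e j) = (i == j)%:R)
  d (Omega : measurableType d) (P : probability Omega R)
  (W : H -> Omega -> R) (HW : isonormal ip P W).
Local Notation PP := (P \x P)%E.
Local Notation xi := (fun w i => W (e i) w).

Lemma chaos_polyfun_L2 n f : chaos_polyfun e P W n f -> L2 P (fun w => f (xi w)).
Proof. by move=> [pf _]; exact/all_moments_L2/(polyfun_moments ortho HW pf). Qed.

(** With the first copy fixed, integrating over the second turns g into x^n g, by the second
    condition of [chaos_polyfun]. *)
Lemma mehler_integral n k f g (x y : R) : polyfun k f -> chaos_polyfun e P W n g ->
  x ^+ 2 + y ^+ 2 = 1 ->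
  (\int[PP]_w (f (xi w.1) * g (fun i => x * W (e i) w.1 + y * W (e i) w.2)) =
   x ^+ n * \int[P]_w (f (xi w) * g (xi w)))%R.
Proof.
move=> pf [pg mg] xy.
have af := polyfun_moments ortho HW pf.
have ag := polyfun_moments ortho HW pg.
have axi i : all_moments PP (fun w => x * W (e i) w.1 + y * W (e i) w.2).
  have aW := coord_all_moments ortho HW i.
  apply: all_momentsD; apply: all_momentsM; try exact: all_moments_cst.
  - exact: all_moments_fst.
  - exact: all_moments_snd.
have ah : all_moments PP (fun w => f (xi w.1) * g (fun i => x * W (e i) w.1 + y * W (e i) w.2)).
  apply: all_momentsM; first exact: (all_moments_fst P af).
  exact: (polyfun_all_moments axi pg).
have isec (w : Omega) : P.-integrable setT (EFin \o (fun w' => g (fun i => x * W (e i) w + y * W (e i) w'))).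
  apply: all_moments_integrable.
  exact: (polyfun_moments ortho HW (polyfun_affine x y (xi w) pg)).
have isec' (w' : Omega) : P.-integrable setT (EFin \o (fun w => f (xi w) * g (fun i => x * W (e i) w + y * W (e i) w'))).
  apply: all_moments_integrable; apply: all_momentsM => //.
  have := polyfun_moments ortho HW (polyfun_affine y x (xi w') pg).
  by under eq_fun do under eq_fun do rewrite addrC.
have [_ <-] := Rintegral_Fubini (all_moments_integrable ah)
  (fun w => integrableZl measurableT (f (xi w)) (isec w)) isec'.
rewrite -RintegralZl//; last by exact: (L2_mul (all_moments_L2 af) (all_moments_L2 ag)).
apply: eq_Rintegral => w _.
by rewrite /= RintegralZl// mg// mulrCA.
Qed.

(** The pair formed by xi and x xi + y xi' is exchangeable, so x^n E[f g] = x^m E[f g]. *)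
Lemma chaos_polyfun_orthogonal m n f g : m != n ->
  chaos_polyfun e P W m f -> chaos_polyfun e P W n g ->
  (\int[P]_w (f (xi w) * g (xi w)))%R = 0.
Proof.
move=> mn cf cg.
(* The point (3/5, 4/5); it suffices that x is positive and different from 1. *)
pose x := circ_x (2^-1 : R); pose y := circ_y (2^-1 : R).
have xy : x ^+ 2 + y ^+ 2 = 1 := circ_unit _.
have xE : x = 3 / 5 by rewrite /x /circ_x; field.
have E1 := mehler_integral cf.1 cg xy.
have E2 := mehler_integral cg.1 cf xy.
have E : (\int[PP]_w (f (xi w.1) * g (fun i => x * W (e i) w.1 + y * W (e i) w.2)) =
    \int[PP]_w (g (xi w.1) * f (fun i => x * W (e i) w.1 + y * W (e i) w.2)))%R.
  rewrite /Rintegral; congr fine.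
  have mfg : measurable_fun setT (fun z : @path_space R (bool * I) =>
      (f (fun i => z (true, i)) * g (fun i => z (false, i)))%:E).
    apply/measurable_EFinP; apply: measurable_funM.
      exact: (measurableT_comp (measurable_polyfun cf.1) (measurable_half true)).
    exact: (measurableT_comp (measurable_polyfun cg.1) (measurable_half false)).
  transitivity (\int[PP]_w (f (fun i => 1 * W (e i) w.1 + 0 * W (e i) w.2) * g (fun i => x * W (e i) w.1 + y * W (e i) w.2))%:E)%E.
    apply: eq_integral => w _; congr (f _ * _)%:E.
    by apply/funext => i; rewrite mul1r mul0r addr0.
  transitivity (\int[PP]_w (f (fun i => x * W (e i) w.1 + y * W (e i) w.2) * g (fun i => 1 * W (e i) w.1 + 0 * W (e i) w.2))%:E)%E.
    apply: (rotated_integral Hip ortho HW (F := fun z z' => (f z * g z')%:E) mfg); lra.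
  apply: eq_integral => w _; rewrite mulrC; congr (g _ * _)%:E.
  by apply/funext => i; rewrite mul1r mul0r addr0.
move: E; rewrite E1 E2 => /eqP.
under [X in _ == x ^+ m * X]eq_Rintegral do rewrite mulrC.
rewrite -subr_eq0 -mulrBl mulf_eq0 => /orP[|/eqP//].
rewrite subr_eq0 => /eqP/ieexprIn h; exfalso; move: mn; rewrite h ?eqxx// xE.
- by rewrite divr_gt0.
- by apply/eqP => h'; lra.
Qed.

Lemma chaos_span_L2 n Y : chaos_span e W n Y -> L2 P Y.
Proof. by move=> /(chaos_spanP Hip ortho HW)[f cf ->]; exact: chaos_polyfun_L2 cf. Qed.

Lemma in_chaos_orthogonal m n X Z : m != n ->
  in_chaos e P W m X -> in_chaos e P W n Z -> (\int[P]_w (X w * Z w))%R = 0.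
Proof.
move=> mn [LX aX] [LZ aZ].
have half V : chaos_span e W n V -> (\int[P]_w (X w * V w))%R = 0.
  move=> sV; apply: (integral_mul_approx LX (chaos_span_L2 sV)) => eps eps0.
  have [Y [sY XY]] := aX _ eps0; exists Y; split=> //; first exact: chaos_span_L2 sY.
  have [f cf ->] := chaos_spanP Hip ortho HW sY.
  have [g cg ->] := chaos_spanP Hip ortho HW sV.
  exact: chaos_polyfun_orthogonal mn cf cg.
under eq_Rintegral do rewrite mulrC.
apply: (integral_mul_approx LZ LX) => eps eps0.
have [V [sV ZV]] := aZ _ eps0; exists V; split=> //; first exact: chaos_span_L2 sV.
by under eq_Rintegral do rewrite mulrC; exact: half.
Qed.

(** Both [Y] and [Xp p] differ from [X] by something orthogonal to the p-th chaos. Their difference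
    is orthogonal to that chaos, in particular to each of them, so its norm is zero. *)
Lemma chaos_proj_unique q p X Y (Xp : nat -> Omega -> R) : (p <= q)%N ->
  measurable_fun setT X ->
  (forall p, (p <= q)%N -> in_chaos e P W p (Xp p)) ->
  {ae P, forall w, X w = \sum_(k < q.+1) Xp k w} ->
  is_chaos_proj e P W p X Y -> {ae P, forall w, Y w = Xp p w}.
Proof.
move=> pq mX cX XE [cY pY].
have cXp := cX p pq.
pose X' w := \sum_(k < q.+1) Xp k w.
have cXk (k : 'I_q.+1) : in_chaos e P W k (Xp k) by apply: cX; rewrite -ltnS.
have LX' : L2 P X' by apply: L2_sum => k; case: (cXk k).
have LY : L2 P Y by case: cY.
have LXp : L2 P (Xp p) by case: cXp.
have h1 Z : in_chaos e P W p Z -> (\int[P]_w ((X' w - Y w) * Z w))%R = 0.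
  move=> cZ; have LZ : L2 P Z by case: cZ.
  rewrite /Rintegral (_ : integral _ _ _ = 0%E)//.
  rewrite -(pY Z cZ); apply: ae_eq_integral => //.
  - apply/measurable_EFinP; apply: measurable_funM; last by case: LZ.
    by case: (L2_sub LX' LY).
  - apply/measurable_EFinP; apply: measurable_funM; last by case: LZ.
    by apply: measurable_funB => //; case: LY.
  - by apply: filterS XE => w /= E _; rewrite E.
have h2 Z : in_chaos e P W p Z -> (\int[P]_w ((X' w - Xp p w) * Z w))%R = 0.
  move=> cZ; have LZ : L2 P Z by case: cZ.
  have E w : (X' w - Xp p w) * Z w = \sum_(k <- seq.filter (fun k : 'I_q.+1 => (k : nat) != p) (enum 'I_q.+1)) Xp k w * Z w.
    have -> : X' w - Xp p w = \sum_(k < q.+1 | (k : nat) != p) Xp k w.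
      rewrite [X' w](bigD1 (Ordinal (pq : (p < q.+1)%N)))//=.
      by rewrite [LHS]addrC addKr.
    by rewrite mulr_suml big_filter big_enum_cond.
  under eq_Rintegral do rewrite E.
  elim: (enum _) => [|k s IH] /=; first by under eq_Rintegral do rewrite big_nil; rewrite Rintegral_cst//= mul0r.
  case: ifP => // kp; under eq_Rintegral do rewrite big_cons.
  have iks (r : seq 'I_q.+1) : P.-integrable setT (EFin \o (fun w => \sum_(j <- r) Xp j w * Z w)).
    elim: r => [|j r IHr].
      by have [_ +] := L2_0 P; apply: eq_integrable => // w _; rewrite /= big_nil expr0n.
    have LXj : L2 P (Xp j) by case: (cXk j).
    have := integrableD measurableT (L2_mul LXj LZ) IHr; apply: eq_integrable => // w _.
    by rewrite /= big_cons EFinD.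
  rewrite RintegralD//; last by apply: L2_mul => //; case: (cXk k).
  by rewrite IH addr0; exact: (in_chaos_orthogonal kp (cXk k) cZ).
have LD := L2_sub LY LXp.
have h3 Z : in_chaos e P W p Z -> (\int[P]_w ((Y w - Xp p w) * Z w))%R = 0.
  move=> cZ; have LZ : L2 P Z by case: cZ.
  rewrite -[RHS](subrr 0) -{1}(h2 Z cZ) -(h1 Z cZ) -RintegralB//.
  - by apply: eq_Rintegral => w _; ring.
  - by apply: L2_mul => //; exact: L2_sub.
  - by apply: L2_mul => //; exact: L2_sub.
(* Testing against [Y] and [Xp p] separately dispenses with showing that their difference lies in
   the chaos. *)
have h4 : (\int[P]_w ((Y w - Xp p w) ^+ 2))%R = 0.
  rewrite -[RHS](subrr 0) -{1}(h3 Y cY) -(h3 (Xp p) cXp) -RintegralB//.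
  - by apply: eq_Rintegral => w _; ring.
  - exact: L2_mul.
  - exact: L2_mul.
have h5 : (\int[P]_w `|((Y w - Xp p w) ^+ 2)%:E| = 0)%E.
  under eq_integral do rewrite gee0_abs ?lee_fin ?sqr_ge0//.
  by rewrite integral_sqr_fin// h4.
have mD : measurable_fun setT (fun w => ((Y w - Xp p w) ^+ 2)%:E).
  by have [_ /integrableP[]] := LD.
have := (ae_eq_integral_abs P measurableT mD).1 h5.
apply: filterS => w /= /(_ Logic.I) [] /eqP.
by rewrite sqrf_eq0 subr_eq0 => /eqP.
Qed.

End chaos_orthogonality.

(** * Almost sure convergence *)

Section real_sequences.
Context {R : realType}.

(** The Cauchy criterion with countable quantifiers only, so that divergence is a measurable
    event. *)
Lemma not_is_cvgnP (u : nat -> R) : ~ cvgn u <->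
  exists k : nat, forall N : nat, exists i j : nat, k.+1%:R^-1 < `|u (N + i)%N - u (N + j)%N|.
Proof.
split=> [nu|[k Hk] /cvg_ex[l ul]].
  apply: contra_notP nu => H; apply/cauchy_cvgP/cauchy_exP => eps eps0.
  have [k /= ke] : exists k, k.+1%:R^-1 < eps.
    exists (Num.truncn eps^-1); rewrite invf_plt ?posrE//.
    exact: truncnS_gt.
  have [N HN] : exists N, forall i j, `|u (N + i)%N - u (N + j)%N| <= k.+1%:R^-1.
    apply: contrapT => h; apply: H; exists k => N; apply: contrapT => h'.
    apply: h; exists N => i j; rewrite leNgt; apply/negP => h''.
    by apply: h'; exists i, j.
  exists (u N), N => // n /= Nn; apply: le_lt_trans ke.
  by have := HN 0%N (n - N)%N; rewrite addn0 subnKC.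
have e0 : 0 < k.+1%:R^-1 / 2 :> R by rewrite divr_gt0// invr_gt0.
have /cvgrPdist_lt/(_ _ e0)[N _ HN] := ul.
have [i [j]] := Hk N; apply/negP; rewrite -leNgt.
have h1 := HN (N + i)%N (leq_addr _ _); have h2 := HN (N + j)%N (leq_addr _ _).
rewrite (_ : _ - _ = (l - u (N + j)%N) - (l - u (N + i)%N)); last by ring.
rewrite (le_trans (ler_normB _ _))//.
by rewrite (splitr (k.+1%:R^-1 : R)) lerD// ltW.
Qed.

Lemma sum_half_pow_le1 n : \sum_(0 <= k < n) ((2 : R)^-1) ^+ k.+1 <= 1.
Proof.
suff -> : \sum_(0 <= k < n) ((2 : R)^-1) ^+ k.+1 = 1 - (2^-1) ^+ n.
  by rewrite lerBlDr lerDl exprn_ge0.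
elim: n => [|n IH]; first by rewrite big_geq// expr0 subrr.
by rewrite big_nat_recr//= IH exprS; field.
Qed.

End real_sequences.

Section almost_sure_limits.
Context {R : realType} d (T : measurableType d) (P : probability T R).

(** The sum of all squares has mean at most 1, so it is almost surely finite and its terms tend to
    0. *)
Lemma ae_cvg0_of_summable (D : nat -> T -> R) : (forall n, L2 P (D n)) ->
  (forall n, (\int[P]_w ((D n w) ^+ 2)%:E <= ((2^-1) ^+ n.+1)%:E)%E) ->
  {ae P, forall w, D n w @[n --> \oo] --> 0}.
Proof.
move=> LD iD.
pose S w := (\sum_(n <oo) ((D n w) ^+ 2)%:E)%E.
have mD n : measurable_fun setT (fun w => ((D n w) ^+ 2)%:E).
  by have [_ /integrableP[]] := LD n.
have D0 n w : (0 <= ((D n w) ^+ 2)%:E)%E by rewrite lee_fin sqr_ge0.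
have mS : measurable_fun setT S by exact: ge0_emeasurable_sum.
have S0 w : (0 <= S w)%E by apply: nneseries_ge0 => n _ _.
have iS : (\int[P]_w S w <= 1)%E.
  rewrite /S integral_nneseries//.
  apply: lime_le; first by apply: is_cvg_nneseries => n _ _; exact: integral_ge0.
  apply: nearW => n; apply: (@le_trans _ _ (\sum_(0 <= k < n) ((2^-1) ^+ k.+1)%:E)%E).
    by apply: lee_sum => k _.
  by rewrite sumEFin lee_fin sum_half_pow_le1.
have integrableS : P.-integrable setT S.
  apply/integrableP; split=> //; under eq_integral do rewrite gee0_abs//.
  by rewrite (le_lt_trans iS)// ltry.
have := integrable_ae measurableT integrableS.
apply: filterS => w /= /(_ Logic.I) Sfin.
have cs : cvgn (series (fun n => (D n w) ^+ 2)).
  apply: nondecreasing_is_cvgn.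
    apply/nondecreasing_seqP => n; rewrite /series/= big_nat_recr//= lerDl sqr_ge0//.
  exists (fine (S w)) => _ [n _ <-].
  rewrite -lee_fin fineK// /series/= -sumEFin.
  by apply: nneseries_lim_ge => k _ _; exact: D0.
have := cvg_series_cvg_0 cs => /cvgrPdist_lt H.
apply/cvgrPdist_lt => eps eps0; near=> n.
rewrite sub0r normrN -ltr_sqr ?nnegrE ?normr_ge0 ?(ltW eps0)//.
rewrite real_normK ?num_real//.
have : `|0 - D n w ^+ 2| < eps ^+ 2 by near: n; apply: H; rewrite exprn_gt0.
by rewrite sub0r normrN ger0_norm ?sqr_ge0.
Unshelve. all: by end_near. Qed.

Lemma ae_limit (Y : nat -> T -> R) : (forall n, measurable_fun setT (Y n)) ->
  {ae P, forall w, cvgn (fun n => Y n w)} ->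
  exists2 X : T -> R, measurable_fun setT X & {ae P, forall w, Y n w @[n --> \oo] --> X w}.
Proof.
move=> mY [N [mN N0 sN]].
(* Cutting off on the null set gives convergence everywhere, hence a measurable limit. *)
pose Y' n w := Y n w * \1_(~` N) w.
have cY' w : Y' n w @[n --> \oo] --> limn (fun n => Y' n w).
  rewrite /Y'; have [wN|wN] := pselect (N w).
    rewrite indicE memNset//=; under eq_fun do rewrite mulr0.
    exact: is_cvg_cst.
  rewrite indicE mem_set//=; under eq_fun do rewrite mulr1.
  by apply: contrapT => h; exact: wN (sN w h).
exists (fun w => limn (fun n => Y' n w)).
  apply: (measurable_fun_cvg (h := Y')) => [n|w _]; last exact: cY'.
  by apply: measurable_funM => //; apply: measurable_indic; exact: measurableC.
exists N; split=> // w /= h; apply: contrapT => wN; apply: h.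
have := cY' w; rewrite /Y' indicE mem_set//=.
by under eq_fun do rewrite mulr1.
Qed.

(** Fatou's lemma, applied with one index fixed, turns the Cauchy bound into a distance to the
    limit. *)
Lemma ae_limit_L2 (Y : nat -> T -> R) (X : T -> R) : (forall n, L2 P (Y n)) ->
  measurable_fun setT X -> {ae P, forall w, Y n w @[n --> \oo] --> X w} ->
  (forall eps : R, 0 < eps -> exists N, forall m n, (N <= m)%N -> (N <= n)%N ->
     (\int[P]_w ((Y m w - Y n w) ^+ 2)%:E <= eps%:E)%E) ->
  forall eps : R, 0 < eps -> exists n, (\int[P]_w ((X w - Y n w) ^+ 2)%:E <= eps%:E)%E.
Proof.
move=> LY mX cY L2c eps eps0; have [N HN] := L2c eps eps0; exists N.
pose f m w := ((Y m w - Y N w) ^+ 2)%:E.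
have mY n : measurable_fun setT (Y n) by case: (LY n).
have mf m : measurable_fun setT (f m).
  by apply/measurable_EFinP/measurable_funX; exact: measurable_funB.
have f0 m w : setT w -> (0 <= f m w)%E by move=> _; rewrite lee_fin sqr_ge0.
have mlim : measurable_fun setT (fun w => limn_einf (f ^~ w)).
  under eq_fun do rewrite limn_einf_lim.
  apply: (@emeasurable_fun_cvg _ _ _ _ (fun n w => einfs (f ^~ w) n)).
    by move=> n; exact: measurable_fun_einfs.
  by move=> w _; exact: is_cvg_einfs.
have -> : (\int[P]_w ((X w - Y N w) ^+ 2)%:E = \int[P]_w limn_einf (f ^~ w))%E.
  apply: ae_eq_integral => //.
    by apply/measurable_EFinP/measurable_funX; exact: measurable_funB.
  apply: filterS cY => w cYw _; apply/esym.
  have h : (f n w @[n --> \oo] --> ((X w - Y N w) ^+ 2)%:E)%E.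
    apply: cvg_EFin; first exact: nearW.
    have h : Y n w - Y N w @[n --> \oo] --> X w - Y N w.
      by apply: cvgB => //; exact: cvg_cst.
    exact: (cvgM h h).
  by have [-> _] := cvg_limn_einf_sup h.
apply: (le_trans (fatou P measurableT mf f0)).
rewrite limn_einf_lim; apply: lime_le; first exact: is_cvg_einfs.
apply: nearW => n; apply: ge_ereal_inf.
exists (\int[P]_w f (maxn n N) w)%E; first by exists (maxn n N) => //=; exact: leq_maxl.
by apply: HN => //; exact: leq_maxr.
Qed.

End almost_sure_limits.

Section path_space_convergence.
Context {R : realType} (J : Type).

(** As an event on path space, divergence can be transported between families with the same law. *)
Definition divergence_set (f : nat -> (J -> R) -> R) : set (path_space J) :=
  [set z | ~ cvgn (fun n => f n z)].

Lemma measurable_divergence_set (f : nat -> (J -> R) -> R) :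
  (forall n, measurable_fun setT (f n : path_space J -> R)) -> measurable (divergence_set f).
Proof.
move=> mf.
have -> : divergence_set f = \bigcup_k \bigcap_N \bigcup_i \bigcup_j
    [set z : path_space J | k.+1%:R^-1 < `|f (N + i)%N z - f (N + j)%N z|].
  apply/seteqP; split=> z.
    move=> /(not_is_cvgnP (fun n => f n z)).1[k Hk]; exists k => // N _.
    by have [i [j h]] := Hk N; exists i => //; exists j.
  move=> [k _ Hk]; apply/(not_is_cvgnP (fun n => f n z)); exists k => N.
  by have [i _ [j _ h]] := Hk N Logic.I; exists i, j.
apply: bigcupT_measurable => k; apply: bigcapT_measurable => N.
apply: bigcupT_measurable => i; apply: bigcupT_measurable => j.
have mg : measurable_fun setT (fun z : path_space J => `|f (N + i)%N z - f (N + j)%N z|).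
  by apply: measurableT_comp => //; exact: measurable_funB.
have := mg measurableT `]k.+1%:R^-1, +oo[%classic (measurable_itv _).
rewrite setTI; congr (measurable _).
by apply/seteqP; split=> x /=; rewrite in_itv/= andbT.
Qed.

End path_space_convergence.

Section square_integrable_sequences.
Context {R : realType} d (T : measurableType d) (P : probability T R).

Lemma L2_integrable X : L2 P X -> P.-integrable setT (EFin \o X).
Proof.
have L1 : L2 P (fun=> 1).
  split=> //; under eq_fun do rewrite expr1n.
  exact: finite_measure_integrable_cst.
by move=> LX; have := L2_mul LX L1; apply: eq_integrable => // w _; rewrite /= mulr1.
Qed.

Lemma Rintegral_sum (K : Type) (s : seq K) (X : K -> T -> R) :
  (forall k, P.-integrable setT (EFin \o X k)) ->
  (\int[P]_w \sum_(k <- s) X k w = \sum_(k <- s) \int[P]_w X k w)%R.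
Proof.
move=> iX.
suff [_ ->] : P.-integrable setT (EFin \o (fun w => \sum_(k <- s) X k w)) /\
  (\int[P]_w \sum_(k <- s) X k w = \sum_(k <- s) \int[P]_w X k w)%R by [].
elim: s => [|k s [iS IH]].
  under eq_fun do rewrite big_nil; rewrite big_nil; split.
    exact: finite_measure_integrable_cst.
  by rewrite Rintegral_cst//= mul0r.
under eq_fun do rewrite big_cons; rewrite big_cons; split.
  by have := integrableD measurableT (iX k) iS.
by rewrite RintegralD// IH.
Qed.

Lemma is_cvg_Rintegral_L2 (Y : nat -> T -> R) : (forall n, L2 P (Y n)) ->
  (forall eps : R, 0 < eps -> exists N, forall m n, (N <= m)%N -> (N <= n)%N ->
     (\int[P]_w ((Y m w - Y n w) ^+ 2)%:E <= eps%:E)%E) ->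
  cvgn (fun n => \int[P]_w Y n w)%R.
Proof.
move=> LY L2c; apply/cauchy_cvgP/cauchy_exP => eps eps0.
(* By |x| <= x^2 / (2 a) + a / 2, a mean square of at most a^2 yields a mean absolute value of at
   most a < eps. *)
pose a := eps / 2; have a0 : 0 < a by rewrite divr_gt0.
have [N HN] := L2c (a ^+ 2) (exprn_gt0 _ a0).
exists (\int[P]_w Y N w)%R, N => // n /= Nn.
have LD := L2_sub (LY N) (LY n); have iD := L2_integrable LD.
have [_ iDD] := LD.
have := HN _ _ (leqnn N) Nn; rewrite integral_sqr_fin// lee_fin => HD.
rewrite /ball/= -RintegralB//; [|exact: L2_integrable|exact: L2_integrable].
apply: le_lt_trans (le_normr_Rintegral measurableT iD) _.
have i1 := integrableZl measurableT (2 * a)^-1 iDD.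
have i2 : P.-integrable setT (EFin \o cst (a / 2)) by exact: finite_measure_integrable_cst.
have i3 : P.-integrable setT (EFin \o (fun w => (2 * a)^-1 * (Y N w - Y n w) ^+ 2 + a / 2)).
  by have := integrableD measurableT i1 i2.
apply: (@le_lt_trans _ _ (\int[P]_w ((2 * a)^-1 * (Y N w - Y n w) ^+ 2 + a / 2))%R).
  apply: le_Rintegral => //.
    by have := integrable_abse iD.
  move=> w _; rewrite -(real_normK (num_real (Y N w - Y n w))).
  have h := sqr_ge0 (`|Y N w - Y n w| - a).
  have E : (2 * a)^-1 * `|Y N w - Y n w| ^+ 2 + a / 2 =
     `|Y N w - Y n w| + (`|Y N w - Y n w| - a) ^+ 2 / (2 * a) by field; lra.
  by rewrite E lerDl mulr_ge0// invr_ge0 mulr_ge0// ltW.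
rewrite RintegralD// RintegralZl// Rintegral_cst//= probability_setT/= mulr1.
apply: (@le_lt_trans _ _ ((2 * a)^-1 * a ^+ 2 + a / 2)).
  by rewrite lerD2r ler_pM2l// invr_gt0 mulr_gt0.
have -> : (2 * a)^-1 * a ^+ 2 + a / 2 = a by field; lra.
by rewrite /a; lra.
Qed.

End square_integrable_sequences.

(** * Convergence of the chaos components *)

Section chaos_components.
Context {R : realType} {H : normedModType R} {ip : H -> H -> R} (Hip : is_inner_product ip).
Context {I : eqType} {e : I -> H} (ortho : forall i j, ip (e i) (e j) = (i == j)%:R).
Context {d} {Omega : measurableType d} {P : probability Omega R} {W : H -> Omega -> R}.
Hypothesis HW : isonormal ip P W.
Local Notation xi := (fun (w : Omega) (i : I) => W (e i) w).

(** The events that the sequence oscillates by more than delta after time N decrease to a null set.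
    Once their probability is at most [c], the second moment bound applies to f_m - f_n, still of
    degree at most [q]. *)
Lemma polyfun_L2_cauchy q (f : nat -> (I -> R) -> R) : (forall n, polyfun q (f n)) ->
  {ae P, forall w, cvgn (fun n => f n (xi w))} ->
  forall eps : R, 0 < eps -> exists N, forall m n, (N <= m)%N -> (N <= n)%N ->
    (\int[P]_w ((f m (xi w) - f n (xi w)) ^+ 2)%:E <= eps%:E)%E.
Proof.
move=> pf cf eps eps0.
have [c [K [c0 K0 bound]]] := second_moment_bound Hip ortho HW q.
(* Makes the resulting bound K delta^2 equal to [eps]. *)
pose delta := Num.sqrt (eps / K).
have delta0 : 0 < delta by rewrite sqrtr_gt0 divr_gt0.
pose A i j := [set w | delta < `|f i (xi w) - f j (xi w)|].
have mA i j : measurable (A i j).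
  have mf n : measurable_fun setT (fun w => f n (xi w)) by case: (polyfun_moments ortho HW (pf n)).
  have mg : measurable_fun setT (fun w => `|f i (xi w) - f j (xi w)|).
    by apply: measurableT_comp => //; exact: measurable_funB.
  have := mg measurableT `]delta, +oo[%classic (measurable_itv _).
  rewrite setTI; congr (measurable _).
  by apply/seteqP; split=> x /=; rewrite in_itv/= andbT.
pose D N := \bigcup_i \bigcup_j A (N + i)%N (N + j)%N.
have mD N : measurable (D N).
  by apply: bigcupT_measurable => i; apply: bigcupT_measurable => j.
have mDD : measurable (\bigcap_N D N) by exact: bigcapT_measurable.
have D0 : P (\bigcap_N D N) = 0%E.
  apply: measure_negligible => //; apply: negligibleS cf => w Dw.
  apply/(not_is_cvgnP (fun n => f n (xi w))).
  have [k ke] : exists k, k.+1%:R^-1 < delta.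
    exists (Num.truncn delta^-1); rewrite invf_plt ?posrE//.
    exact: truncnS_gt.
  exists k => N; have [i _ [j _ h]] := Dw N Logic.I.
  by exists i, j; exact: lt_trans ke h.
have homD : {homo D : n m / (n <= m)%N >-> (m <= n)%O}.
  move=> m n mn; apply/subsetPset => w [i _ [j _ h]].
  exists (n - m + i)%N => //; exists (n - m + j)%N => //.
  by rewrite !addnA subnKC.
have cD := nonincreasing_cvg_mu (le_lt_trans (probability_le1 P (mD 0%N)) (ltry 1)) mD mDD homD.
have [N HN] : exists N, (P (D N) <= c%:E)%E.
  have := eq_ind _ (fun l => (P \o D) n @[n --> \oo] --> l) cD _ D0.
  move=> /fine_cvgP[_ /cvgrPdist_lt/(_ _ c0)[N _ /(_ N (leqnn N))]] /=.
  rewrite sub0r normrN ger0_norm ?fine_ge0// => h.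
  exists N; rewrite -(@fineK _ (P (D N))) ?fin_num_measure//.
  by rewrite lee_fin ltW.
exists N => m n Nm Nn.
have := bound (fun z => f m z - f n z) delta (polyfun_sub (pf m) (pf n)) delta0.
rewrite sqr_sqrtr; last by rewrite divr_ge0// ltW.
rewrite (_ : K * (eps / K) = eps); last by rewrite mulrC divfK// gt_eqF.
apply; apply: le_trans HN; apply: le_measure; rewrite ?inE//.
  exact: mA.
move=> w h; exists (m - N)%N => //; exists (n - N)%N => //.
by rewrite !subnKC.
Qed.

(** Rotation invariance makes the divergence event null on the product space, so almost every
    section of it is null. *)
Lemma rotated_ae_cvg q (f : nat -> (I -> R) -> R) x y : x ^+ 2 + y ^+ 2 = 1 ->
  (forall n, polyfun q (f n)) -> {ae P, forall w, cvgn (fun n => f n (xi w))} ->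
  {ae P, forall w, {ae P, forall w', cvgn (fun n => f n (fun i => x * W (e i) w + y * W (e i) w'))}}.
Proof.
move=> xy pf cf.
have mD := measurable_divergence_set (fun n => measurable_polyfun (pf n)).
have gram (j l : I) : gaussian_gram (cst x) id (cst y) id j l = (j == l)%:R.
  by rewrite /gaussian_gram/= -mulrDl -!expr2 xy mul1r.
have law := gaussian_pair_same_law1 Hip ortho HW gram.
set S := (fun w : Omega * Omega => (gaussian_pair e W (cst x) id (cst y) id)^~ w) @^-1` divergence_set f.
have mS : measurable S.
  have := measurable_path (measurable_gaussian_pair e HW (cst x) id (cst y) id).
  by move=> /(_ measurableT _ mD); rewrite setTI.
have S0 : (P \x P)%E S = 0%E.
  rewrite (law _ mD); apply: measure_negligible.
    by have := measurable_xi e HW measurableT mD; rewrite setTI.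
  exact: negligibleS cf.
have mx := measurable_fun_xsection P mS.
have : (\int[P]_w `|(P \o xsection S) w| = 0)%E.
  by under eq_integral do rewrite gee0_abs//; exact: S0.
move/(ae_eq_integral_abs P measurableT mx); apply: filterS => w /(_ Logic.I) /= h.
exists (xsection S w); split=> //; first exact: measurable_xsection.
by move=> w' /= h'; rewrite /xsection/= inE.
Qed.

Lemma chaos_component_ae_cvg q (g : nat -> nat -> (I -> R) -> R) :
  (forall n p, (p <= q)%N -> chaos_polyfun e P W p (g n p)) ->
  {ae P, forall w, cvgn (fun n => \sum_(p < q.+1) g n p (xi w))} ->
  forall p, (p <= q)%N -> {ae P, forall w, cvgn (fun n => g n p (xi w))}.
Proof.
move=> cg cG p pq.
pose G n z := \sum_(p < q.+1) g n p z.
have pg n (k : 'I_q.+1) : polyfun q (g n k).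
  by apply: polyfun_leq (cg n k _).1; rewrite -ltnS.
have pG n : polyfun q (G n) by exact: polyfun_sum.
pose v j : R := circ_x j.+1%:R^-1.
have vinj : injective v.
  move=> j k /circ_x_inj; rewrite !nnegrE !invr_ge0 => /(_ (ler0n _ _) (ler0n _ _)) /invr_inj.
  by move/eqP; rewrite eqr_nat eqSS => /eqP.
(* For almost every fixed w, the rotated polynomials in the second copy converge almost surely,
   hence so do their means, which Mehler's formula computes. *)
have cv j : {ae P, forall w, cvgn (fun n => \sum_(k < q.+1) v j ^+ k * g n k (xi w))}.
  have := rotated_ae_cvg (circ_unit j.+1%:R^-1) pG cG.
  apply: filterS => w cw.
  pose f n z := G n (fun i => v j * W (e i) w + circ_y j.+1%:R^-1 * z i).
  have pf n : polyfun q (f n) by exact: polyfun_affine.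
  have L2f n : L2 P (fun w' => f n (xi w')).
    exact: all_moments_L2 (polyfun_moments ortho HW (pf n)).
  rewrite (_ : (fun _ => _) = (fun n => \int[P]_w' f n (xi w'))%R).
    exact: is_cvg_Rintegral_L2 L2f (polyfun_L2_cauchy pf cw).
  apply/funext => n; rewrite Rintegral_sum.
    apply: eq_bigr => k _; apply/esym; apply: (cg n k _).2.
      by rewrite -ltnS.
    exact: circ_unit.
  move=> k; apply: L2_integrable; apply: all_moments_L2.
  exact: (polyfun_moments ortho HW
    (polyfun_affine (v j) (circ_y j.+1%:R^-1) (xi w) (pg n k))).
have := ae_foralln cv; apply: filterS => w cw.
have [l Hl] := interpolation q.+1 p vinj.
rewrite (_ : (fun n => _) = (fun n => \sum_(j < q.+1) l j * \sum_(k < q.+1) v j ^+ k * g n k (xi w))).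
  apply/cvg_ex; exists (\sum_(j < q.+1) l j * limn (fun n => \sum_(k < q.+1) v j ^+ k * g n k (xi w))).
  apply: (cvg_big (op := +%R)) => [|j _]; first exact: add_continuous.
  by apply: cvgM; [exact: cvg_cst|exact: cw].
(* The sums in [cv] are the values at [v j] of this polynomial, whose p-th coefficient is the
   component sought. *)
apply/funext => n; have := Hl (\poly_(k < q.+1) g n k (xi w)) (size_poly _ _).
rewrite coef_poly ltnS pq => ->; apply: eq_bigr => j _; congr (_ * _).
by rewrite horner_poly; apply: eq_bigr => k _; rewrite mulrC.
Qed.

Lemma in_chaos_approx p X (eps : R) : in_chaos e P W p X -> 0 < eps ->
  exists g, [/\ chaos_polyfun e P W p g, chaos_span e W p (fun w => g (xi w)) &
    (\int[P]_w ((X w - g (xi w)) ^+ 2)%:E <= eps%:E)%E].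
Proof.
move=> [_ aX] eps0; have [Y [sY XY]] := aX eps eps0.
have [g cg gY] := chaos_spanP Hip ortho HW sY.
by exists g; split=> //; rewrite -?gY// gY in XY *; exact: ltW.
Qed.

Lemma in_chaos_limit p (g : nat -> (I -> R) -> R) :
  (forall n, chaos_polyfun e P W p (g n)) ->
  (forall n, chaos_span e W p (fun w => g n (xi w))) ->
  {ae P, forall w, cvgn (fun n => g n (xi w))} ->
  exists X, in_chaos e P W p X /\ {ae P, forall w, g n (xi w) @[n --> \oo] --> X w}.
Proof.
move=> cg sg cvg_g.
have L2g n : L2 P (fun w => g n (xi w)) by exact: chaos_polyfun_L2 (cg n).
have [X mX gX] := ae_limit (fun n => (L2g n).1) cvg_g.
have L2c := polyfun_L2_cauchy (fun n => (cg n).1) cvg_g.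
have app := ae_limit_L2 L2g mX gX L2c.
exists X; split=> //; split.
  (* The limit is square integrable because it is at finite distance from some g_N. *)
  have [N HN] := app 1 ltr01.
  have LD : L2 P (fun w => X w - g N (xi w)).
    have mD : measurable_fun setT (fun w => X w - g N (xi w)).
      by apply: measurable_funB => //; exact: (L2g N).1.
    split=> //; apply/integrableP; split.
      by apply/measurable_EFinP/measurable_funX.
    under eq_integral do rewrite gee0_abs ?lee_fin ?sqr_ge0//.
    exact: le_lt_trans HN (ltry _).
  by have := L2_add LD (L2g N); under eq_fun do rewrite subrK.
(* Half of [eps], since [in_chaos] asks for a strict inequality. *)
move=> eps eps0; have [N HN] := app (eps / 2) (divr_gt0 eps0 (ltr0n _ 2)).
exists (fun w => g N (xi w)); split=> //; apply: le_lt_trans HN _.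
by rewrite lte_fin; lra.
Qed.

End chaos_components.

Unset Implicit Arguments.
Set Strict Implicit.
Set Printing Implicit Defensive.

Theorem theorem1p1 (R : realType) (H : completeNormedModType R)
  (ip : H -> H -> R) (Hip : is_inner_product ip)
  (I : countType) (e : I -> H) (He : is_orthonormal_basis ip e)
  (d : measure_display) (Omega : measurableType d) (P : probability Omega R)
  (W : H -> Omega -> R) (HW : isonormal ip P W)
  (q : nat) (hq : (2 <= q)%N)
  (Fn : nat -> Omega -> R) (F : Omega -> R)
  (mFn : forall n, measurable_fun setT (Fn n)) (mF : measurable_fun setT F)
  (HFn : forall n, in_chaos_sum e P W q (Fn n))
  (Hcvg : {ae P, forall w, Fn n w @[n --> \oo] --> F w}) :
  in_chaos_sum e P W q F /\
  forall (JFn : nat -> nat -> Omega -> R) (JF : nat -> Omega -> R),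
    (forall n p, (p <= q)%N -> is_chaos_proj e P W p (Fn n) (JFn n p)) ->
    (forall p, (p <= q)%N -> is_chaos_proj e P W p F (JF p)) ->
    forall p, (p <= q)%N -> {ae P, forall w, JFn n p w @[n --> \oo] --> JF p w}.
Proof.
have [ortho _] := He.
pose xi w i := W (e i) w.
have sum_cvg (u : nat -> nat -> R) (l : nat -> R) :
    (forall p, (p <= q)%N -> u n p @[n --> \oo] --> l p) ->
    \sum_(p < q.+1) u n p @[n --> \oo] --> \sum_(p < q.+1) l p.
  move=> ul; apply: (cvg_big (op := +%R)) => [|k _]; first exact: add_continuous.
  by apply: ul; rewrite -ltnS.
have ae_leq (A : nat -> Omega -> Prop) : (forall p, (p <= q)%N -> {ae P, forall w, A p w}) ->
    {ae P, forall w, forall p, (p <= q)%N -> A p w}.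
  move=> HA; apply: ae_foralln => p; case: (leqP p q) => [pq|_]; last by apply: nearW.
  by apply: filterS (HA p pq).
have [X HX] := choice HFn.
have cX n p (pq : (p <= q)%N) : in_chaos e P W p (X n p) := (HX n).1 p pq.
have sX := ae_foralln (fun n => (HX n).2).
(* The mean square errors are summable in n, so the errors tend to 0 almost surely. For p > q the
   choice is arbitrary. *)
have /choice[g Hg] : forall k : nat * nat, exists f : (I -> R) -> R, (k.2 <= q)%N ->
    [/\ chaos_polyfun e P W k.2 f, chaos_span e W k.2 (fun w => f (xi w)) &
      (\int[P]_w ((X k.1 k.2 w - f (xi w)) ^+ 2)%:E <= ((2^-1) ^+ k.1.+1)%:E)%E].
  move=> [n p] /=; case: (leqP p q) => [pq|_]; last by exists (fun=> 0).
  have h0 : 0 < (2^-1 : R) ^+ n.+1 by rewrite exprn_gt0.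
  by have [f Hf] := in_chaos_approx Hip ortho HW (cX n p pq) h0; exists f.
have cg n p (pq : (p <= q)%N) : chaos_polyfun e P W p (g (n, p)) by case: (Hg (n, p) pq).
have cD : {ae P, forall w, forall p, (p <= q)%N ->
    X n p w - g (n, p) (xi w) @[n --> \oo] --> 0}.
  apply: ae_leq => p pq; apply: ae_cvg0_of_summable => n; last by case: (Hg (n, p) pq).
  apply: L2_sub; first by case: (cX n p pq).
  exact: (chaos_polyfun_L2 ortho HW (cg n p pq)).
have cG : {ae P, forall w, \sum_(p < q.+1) g (n, val p) (xi w) @[n --> \oo] --> F w}.
  move: Hcvg sX cD; apply: filterS3 => w cF EX cDw.
  rewrite (_ : (fun n => _) =
    (fun n => Fn n w - \sum_(p < q.+1) (X n p w - g (n, val p) (xi w)))); last first.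
    by apply/funext => n; rewrite EX sumrB opprB addrC subrK.
  have := sum_cvg (fun n p => X n p w - g (n, p) (xi w)) (fun=> 0) cDw.
  rewrite big1// => sD; rewrite -[F w]subr0.
  exact: cvgB.
have cGn : {ae P, forall w, cvgn (fun n => \sum_(p < q.+1) g (n, val p) (xi w))}.
  by apply: filterS cG => w cw; apply/cvg_ex; exists (F w).
have cgp := chaos_component_ae_cvg Hip ortho HW (g := fun n p => g (n, p)) cg cGn.
have /choice[Y HY] : forall p, exists Z : Omega -> R, (p <= q)%N ->
    in_chaos e P W p Z /\ {ae P, forall w, g (n, p) (xi w) @[n --> \oo] --> Z w}.
  move=> p; case: (leqP p q) => [pq|_]; last by exists (fun=> 0).
  have sg n : chaos_span e W p (fun w => g (n, p) (xi w)) by case: (Hg (n, p) pq).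
  have [Z HZ] := in_chaos_limit Hip ortho HW (fun n => cg n p pq) sg (cgp p pq).
  by exists Z.
have cY p (pq : (p <= q)%N) : in_chaos e P W p (Y p) := (HY p pq).1.
have gY := ae_leq (fun p w => g (n, p) (xi w) @[n --> \oo] --> Y p w) (fun p pq => (HY p pq).2).
have sY : {ae P, forall w, F w = \sum_(p < q.+1) Y p w}.
  move: cG gY; apply: filterS2 => w cGw gYw.
  by rewrite -(cvg_lim (@Rhausdorff R) cGw) (cvg_lim (@Rhausdorff R) (sum_cvg _ _ gYw)).
split; first by exists Y.
move=> JFn JF HJFn HJF p pq.
(* The given projections are arbitrary versions; they agree almost surely with the components
   [X n p] and [Y p]. *)
have EJF := chaos_proj_unique Hip ortho HW pq mF cY sY (HJF p pq).
have EJFn := ae_foralln (fun n =>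
  chaos_proj_unique Hip ortho HW pq (mFn n) (cX n) (HX n).2 (HJFn n p pq)).
have cXY : {ae P, forall w, X n p w @[n --> \oo] --> Y p w}.
  move: cD gY; apply: filterS2 => w /(_ p pq) cDw /(_ p pq) gYw.
  rewrite (_ : (fun n => _) = (fun n => X n p w - g (n, p) (xi w) + g (n, p) (xi w))).
    by rewrite -[Y p w]add0r; exact: cvgD.
  by apply/funext => n; rewrite subrK.
move: EJF EJFn cXY; apply: filterS3 => w -> EJn.
by rewrite (_ : (fun n => JFn n p w) = (fun n => X n p w))//; exact/funext.
Qed.
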